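(* Suppose that $R:L^\infty((0,d))\to[0,\infty)$ is Gâteaux differentiable, with derivative $R'(\sigma)$ at $\sigma$. If $(\sigma,u)\in\mathcal F$ is a solution to the bilevel problem $$\min_{\sigma\in W_{ad},\,u\in H^s(\Omega)}\ \tfrac12\|u-u^\dagger\|_{L^2(\Omega)}^2+R(\sigma)\quad\text{subject to}\quad(\sigma,u)\in\mathcal F,$$ then there exists $q\in H^s(\Omega)$ such that $$R'(\sigma)[\omega-\sigma]+[\mathcal L^s(\omega-\sigma)u]q\ge0\quad\text{for all }\omega\in W_{ad},$$ $$u-u^\dagger+\mathcal L^s(\sigma)q+S^*Sq=0\quad\text{in }H^s(\Omega)',$$ $$S^*Su-S^*y_\delta+\mathcal L^s(\sigma)u=0\quad\text{in }H^s(\Omega)'.$$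
   Context: Let $s\in(0,1)$, $N\in\mathbb N$, and let $\Omega\subset\mathbb R^N$ be a nonempty, open, connected and bounded Lipschitz domain with diameter $d=\sup_{x,y\in\Omega}|x-y|$. $H^s(\Omega)$ is the usual fractional Sobolev (Sobolev–Slobodeckij) space, $H^s(\Omega)'$ its dual; elements $g\in L^2(\Omega)$ are identified with the functionals $v\mapsto\int_\Omega gv\,dx$ on $H^s(\Omega)$. Fix constants $0<\gamma_1\le\gamma_2$ and $\delta>0$. The set $W_{ad}$ of feasible weights consists of all $\sigma\in L^\infty((0,d))$ with $0\le\sigma(t)\le\gamma_2$ for a.e. $t\in(0,d)$ and $\gamma_1\le\sigma(t)$ for a.e. $t\in(0,d)$ with $t<\delta$. For $\sigma\in L^\infty((0,d))$, the bounded operator $\mathcal L^s(\sigma):H^s(\Omega)\to H^s(\Omega)'$ is $$[\mathcal L^s(\sigma)u]v=\iint_{\Omega\times\Omega}\frac{(u(x)-u(y))(v(x)-v(y))}{|x-y|^{N+2s}}\sigma(|x-y|)\,dx\,dy,$$ and for $\sigma\in W_{ad}$, $|u|_{\sigma,s}^2=[\mathcal L^s(\sigma)u]u$. $S:L^2(\Omega)\to L^2(\Omega)$ is a bounded linear operator with adjoint $S^*$, and $y_\delta,u^\dagger\in L^2(\Omega)$ are given. $\mathcal F$ is the set of $(\sigma,u)\in W_{ad}\times H^s(\Omega)$ such that $u$ solves $$\min_{v\in H^s(\Omega)}\|Sv-y_\delta\|_{L^2(\Omega)}^2+|v|_{\sigma,s}^2 .$$ *)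

(* Defs.v *)
From HB Require Import structures.
From mathcomp Require Import all_boot all_order all_algebra.
From mathcomp Require Import all_classical all_reals all_analysis.
From mathcomp Require Import measurable_realfun.

Set Implicit Arguments.
Unset Strict Implicit.
Unset Printing Implicit Defensive.

Import Order.TTheory GRing.Theory Num.Theory.
Import numFieldNormedType.Exports.

Local Open Scope classical_set_scope.
Local Open Scope ring_scope.

(* The sigma-algebra on 'rV[R]_n is generated by the coordinates; for
   R : realType it is the Borel sigma-algebra (cf. open_measurable_rV). *)

Definition measure_rV_display : measure_display.
Proof. exact: default_measure_display. Qed.

Section measurable_rV.
Context {R : realType} {n : nat}.

Let coor : 'I_n -> 'rV[R]_n -> R := fun i x => x 0 i.

Let rV_set0 : g_sigma_preimage coor set0.
Proof. exact: sigma_algebra0. Qed.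

Let rV_setC A : g_sigma_preimage coor A -> g_sigma_preimage coor (~` A).
Proof. exact: sigma_algebraC. Qed.

Let rV_bigcup (F : (set 'rV[R]_n)^nat) :
  (forall i, g_sigma_preimage coor (F i)) ->
  g_sigma_preimage coor (\bigcup_i (F i)).
Proof. exact: sigma_algebra_bigcup. Qed.

HB.instance Definition _ := @isMeasurable.Build measure_rV_display
  'rV[R]_n (g_sigma_preimage coor) rV_set0 rV_setC rV_bigcup.

End measurable_rV.

Lemma measurable_coord (R : realType) n (i : 'I_n) :
  measurable_fun [set: 'rV[R]_n] (fun x : 'rV[R]_n => x 0 i).
Proof.
move=> _ Y mY; rewrite setTI; apply: sub_sigma_algebra => /=.
rewrite -bigcup_seq/=; exists i => /=; first by rewrite mem_index_enum.
by exists Y => //; rewrite setTI.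
Qed.

Lemma measurable_fun_rVP (R : realType) n d (T : measurableType d)
    (f : T -> 'rV[R]_n) :
  (forall i, measurable_fun [set: T] (fun t => f t 0 i)) ->
  measurable_fun [set: T] f.
Proof.
move=> mf.
pose M : set (set 'rV[R]_n) := [set A | measurable (f @^-1` A)].
suff sM : @measurable _ 'rV[R]_n `<=` M by move=> _ A mA; rewrite setTI; exact: sM.
apply: smallest_sub.
  split; rewrite /M/=.
  - by rewrite preimage_set0.
  - by move=> A mA; rewrite setTD preimage_setC; exact: measurableC.
  - by move=> F mF; rewrite preimage_bigcup; exact: bigcupT_measurable.
rewrite -bigcup_seq/= => A [i _ [B mB <-]]; rewrite /M/= setTI.
by have := mf i measurableT B mB; rewrite setTI.
Qed.

Lemma open_measurable_rV (R : realType) n (A : set 'rV[R]_n) :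
  open A -> measurable A.
Proof.
move=> oA.
pose c (q : 'rV[rat]_n) : 'rV[R]_n := \row_j ratr (q 0 j).
pose B (q : 'rV[rat]_n) (k : nat) : set 'rV[R]_n :=
  [set x | forall j, `|c q 0 j - x 0 j| < k.+1%:R^-1].
have mB q k : measurable (B q k).
  rewrite [X in measurable X](_ : _ = \big[setI/setT]_(j < n)
      ((fun x : 'rV[R]_n => x 0 j) @^-1` (ball (c q 0 j) k.+1%:R^-1))).
    apply: bigsetI_measurable => j _; rewrite -[X in measurable X]setTI.
    by apply: measurable_coord => //; exact: measurable_ball.
  rewrite -bigcap_seq; apply/seteqP; split => x /= Bx.
    by move=> j _; exact: Bx.
  by move=> j; apply: (Bx j); rewrite /= mem_index_enum.
pose F (m : nat) : set 'rV[R]_n :=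
  if unpickle m is Some (q, k) then
    if `[< B q k `<=` A >] then B q k else set0
  else set0.
rewrite [X in measurable X](_ : _ = \bigcup_m F m).
  apply: bigcupT_measurable => m; rewrite /F.
  case: (unpickle m : option ('rV[rat]_n * nat)) => // -[q k].
  by case: ifP.
apply/seteqP; split => [x Ax|x [m _]]; last first.
  rewrite /F; case: (unpickle m : option ('rV[rat]_n * nat)) => // -[q k].
  by case: ifPn => // /asboolP; exact.
have /nbhs_ballP[e /= e0 xeA] : nbhs x A by exact: open_nbhs_nbhs.
have [k ke] : exists k : nat, k.+1%:R^-1 < e / 2 :> R.
  have e20 : 0 < e / 2 by rewrite divr_gt0.
  exists (Num.truncn (e / 2)^-1).
  rewrite invf_plt ?posrE//.
  by rewrite truncnS_gt.
have k0 : 0 < k.+1%:R^-1 :> R by rewrite invr_gt0.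
have hq j : exists q : rat, `|ratr q - x 0 j| < k.+1%:R^-1.
  have [q] : exists q : rat, ratr q \in `]x 0 j, x 0 j + k.+1%:R^-1[.
    by apply: rat_in_itvoo; rewrite ltrDl.
  rewrite in_itv/= => /andP[q1 q2]; exists q.
  by rewrite ger0_norm ?subr_ge0 ?ltW// ltrBlDl.
pose q : 'rV[rat]_n := \row_j projT1 (cid (hq j)).
have Bx : B q k x by move=> j; rewrite !mxE; exact: (projT2 (cid (hq j))).
exists (pickle (q, k)) => //; rewrite /F pickleK; case: ifPn => // /asboolP; case.
move=> y By; apply: xeA; split => // i j; rewrite (ord1 i) /ball/=.
rewrite (_ : x 0 j - y 0 j = (c q 0 j - y 0 j) - (c q 0 j - x 0 j)); last first.
  by rewrite opprB [RHS]addrC addrA subrK.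
apply: (le_lt_trans (ler_normB _ _)); rewrite (splitr e).
by apply: ltrD; apply: lt_trans ke; [exact: By|exact: Bx].
Qed.

(* n-dimensional Lebesgue measure: lambda^(n+1) is the image of
   lambda \x lambda^n under the bijection R * R^n -> R^(n+1). *)

Section lebesgue_rV_step.
Context {R : realType} {n : nat}.

Definition rV_cons (p : R * 'rV[R]_n) : 'rV[R]_n.+1 :=
  row_mx (const_mx p.1 : 'rV_1) p.2.

Lemma rV_consl p (j : 'I_1) : rV_cons p 0 (lshift n j) = p.1.
Proof. by rewrite (row_mxEl (const_mx p.1 : 'rV_1) p.2) mxE. Qed.

Lemma rV_consr p (j : 'I_n) : rV_cons p 0 (rshift 1 j) = p.2 0 j.
Proof. exact: (row_mxEr (const_mx p.1 : 'rV_1) p.2). Qed.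

Lemma measurable_rV_cons : measurable_fun [set: R * 'rV[R]_n] rV_cons.
Proof.
apply: measurable_fun_rVP => i.
have [j ->|j ->] := @split_ordP 1 n i.
- rewrite [X in measurable_fun _ X](_ : _ = fst) //.
  by apply/funext => p; exact: rV_consl.
- rewrite [X in measurable_fun _ X](_ : _ = (fun x : 'rV_n => x 0 j) \o snd).
    by apply: measurableT_comp => //; exact: measurable_coord.
  by apply/funext => p; exact: rV_consr.
Qed.

Variable mu : {sigma_finite_measure set 'rV[R]_n -> \bar R}.

Definition lebesgue_rVS : set 'rV[R]_n.+1 -> \bar R :=
  pushforward (lebesgue_measure \x mu)%E rV_cons.

Let m := @measure_function_pushforward__canonical__measure_function_Measure
  _ _ _ _ _ (lebesgue_measure \x mu)%E _ measurable_rV_cons.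

Let rVS0 : lebesgue_rVS set0 = 0%E. Proof. exact: (@measure0 _ _ _ m). Qed.

Let rVS_ge0 A : (0 <= lebesgue_rVS A)%E.
Proof. exact: (@measure_ge0 _ _ _ m). Qed.

Let rVS_sigma_additive : semi_sigma_additive lebesgue_rVS.
Proof. exact: (@measure_semi_sigma_additive _ _ _ m). Qed.

HB.instance Definition _ := isMeasure.Build _ _ _ lebesgue_rVS
  rVS0 rVS_ge0 rVS_sigma_additive.

Let rV_uncons (x : 'rV[R]_n.+1) : R * 'rV[R]_n :=
  (x 0 ord0, \row_j x 0 (lift ord0 j)).

Let rV_unconsK p : rV_uncons (rV_cons p) = p.
Proof.
case: p => a v; rewrite /rV_uncons; congr pair.
  by rewrite -[RHS](rV_consl (a, v) 0); congr (rV_cons _ 0 _); exact/val_inj.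
apply/rowP => j; rewrite mxE.
by rewrite -[RHS](rV_consr (a, v)); congr (rV_cons _ 0 _); exact/val_inj.
Qed.

Let measurable_uncons : measurable_fun [set: 'rV[R]_n.+1] rV_uncons.
Proof.
apply: measurable_fun_pair; first exact: measurable_coord.
apply: measurable_fun_rVP => i.
under eq_fun do rewrite mxE.
exact: measurable_coord.
Qed.

Let rVS_sigma_finite : sigma_finite setT lebesgue_rVS.
Proof.
have /sigma_finiteP[F [FT ndF mF]] := sigma_finiteT (@lebesgue_measure R).
have /sigma_finiteP[G [GT ndG mG]] := sigma_finiteT mu.
exists (fun k => rV_uncons @^-1` (F k `*` G k)).
  apply/esym; rewrite -subTset => x _.
  have [a _ Fa] : (\bigcup_i F i) (rV_uncons x).1 by rewrite -FT.
  have [b _ Gb] : (\bigcup_i G i) (rV_uncons x).2 by rewrite -GT.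
  exists (maxn a b) => //; split.
    by move: Fa; exact/subsetPset/ndF/leq_maxl.
  by move: Gb; exact/subsetPset/ndG/leq_maxr.
move=> k; have [mFk Fk] := mF k; have [mGk Gk] := mG k; split.
  rewrite -[X in measurable X]setTI.
  by apply: measurable_uncons => //; exact: measurableX.
rewrite /lebesgue_rVS /pushforward -comp_preimage.
rewrite (_ : rV_uncons \o rV_cons = id); last exact/funext/rV_unconsK.
by rewrite preimage_id product_measure1E// lte_mul_pinfty// ge0_fin_numE.
Qed.

HB.instance Definition _ := Measure_isSigmaFinite.Build _ _ _ lebesgue_rVS
  rVS_sigma_finite.

End lebesgue_rV_step.

Fixpoint lebesgue_rV (R : realType) (n : nat) :
    {sigma_finite_measure set 'rV[R]_n -> \bar R} :=
  match n with
  | 0%N => \d_(0 : 'rV[R]_0)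
  | n'.+1 => lebesgue_rVS (lebesgue_rV R n')
  end.
Arguments lebesgue_rV {R n}.

Lemma lebesgue_rV_box (R : realType) n (A : 'I_n -> set R) :
  (forall i, measurable (A i)) ->
  lebesgue_rV [set x : 'rV[R]_n | forall i, A i (x 0 i)]
    = (\prod_(i < n) lebesgue_measure (A i))%E.
Proof.
have mbox k (B : 'I_k -> set R) : (forall i, measurable (B i)) ->
    measurable [set x : 'rV[R]_k | forall i, B i (x 0 i)].
  move=> mB; rewrite [X in measurable X](_ : _ =
      \big[setI/setT]_(i < k) ((fun x : 'rV[R]_k => x 0 i) @^-1` B i)).
    apply: bigsetI_measurable => i _; rewrite -[X in measurable X]setTI.
    exact: measurable_coord.
  rewrite -bigcap_seq; apply/seteqP; split => x /= Bx.
    by move=> i _; exact: Bx.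
  by move=> i; apply: (Bx i); rewrite /= mem_index_enum.
elim: n A => [|n IHn] A mA.
  by rewrite big_ord0 /= diracE mem_set//= => -[].
rewrite big_ord_recl /= /lebesgue_rVS /pushforward.
rewrite -IHn// -[RHS]product_measure1E; first last.
- exact: (mbox n (fun i => A (lift ord0 i))).
- exact: (mA ord0).
congr ((_ \x _)%E _); apply/seteqP; split => -[a v] /=.
  move=> Av; split => [|i].
    have := Av (@lshift 1 n ord0 : 'I_n.+1); rewrite rV_consl.
    by rewrite (_ : @lshift 1 n ord0 = ord0 :> 'I_n.+1)//; exact/val_inj.
  have := Av (rshift 1 i : 'I_n.+1); rewrite rV_consr.
  by rewrite (_ : rshift 1 i = lift ord0 i :> 'I_n.+1)//; exact/val_inj.
move=> [Aa Av] i; have [j ->|j ->] := @split_ordP 1 n i.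
  by rewrite rV_consl (_ : lshift n j = ord0)//; apply/val_inj; rewrite /= ord1.
by rewrite rV_consr (_ : rshift 1 j = lift ord0 j)//; exact/val_inj.
Qed.

Section domain.
Context {R : realType} {N : nat}.
Implicit Types (x y : 'rV[R]_N) (Om : set 'rV[R]_N).

(* `|x| on 'rV[R]_N is the sup norm, which defines the same topology but is
   not the norm entering the kernel |x - y|^(N + 2s). *)
Definition enorm n (x : 'rV[R]_n) : R := Num.sqrt (\sum_j x 0 j ^+ 2).

Definition diam Om : R := sup [set enorm (x - y) | x in Om & y in Om].

(* Near each boundary point p, in coordinates y given by a rotation Q about p,
   Om is the strict epigraph (in the i-th coordinate) of a Lipschitz function
   of the N - 1 remaining coordinates. *)
Definition lipschitz_boundary Om := forall p, (closure Om `\` interior Om) p ->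
  exists (Q : 'M[R]_N) (i : 'I_N) (phi : 'rV[R]_N.-1 -> R) (L r h : R),
    [/\ Q *m Q^T = 1%:M, 0 < r, 0 < h,
        forall a b, `|phi a - phi b| <= L * enorm (a - b) &
        (forall a, enorm a < r -> `|phi a| < h) /\
        forall y, enorm (col' i y) < r -> `|y 0 i| < h ->
          (Om (p + y *m Q) <-> phi (col' i y) < y 0 i)].

End domain.

Section spaces.
Context {R : realType} {N : nat} (Om : set 'rV[R]_N) (oOm : open Om).

(* Elements of L2 and Linf are functions, not classes; everything below is
   invariant under equality almost everywhere. *)

Definition mu_dom : {measure set 'rV[R]_N -> \bar R} :=
  mrestr lebesgue_rV (open_measurable_rV oOm).

Definition L2 := LfunType mu_dom (lee1n 2).

Definition L2dot (f g : L2) : R := \int[lebesgue_rV]_(x in Om) (f x * g x).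

Definition L2norm (f : L2) : R := fine 'N[mu_dom]_2%:E[EFin \o f].

Definition mu_itv : {measure set measurableTypeR R -> \bar R} :=
  mrestr lebesgue_measure (measurable_itv `]0, diam Om[).

Definition Linf := LfunType mu_itv (leey 1).

Definition Linfnorm (sigma : Linf) : R :=
  fine 'N[mu_itv]_+oo[EFin \o sigma].

Definition frac_ker (s : R) (x y : 'rV[R]_N) : R :=
  (enorm (x - y) `^ (N%:R + 2 * s))^-1.

Definition Hs (s : R) : set L2 := [set u |
  (\int[(lebesgue_rV \x lebesgue_rV)%E]_(z in Om `*` Om)
     ((u z.1 - u z.2) ^+ 2 * frac_ker s z.1 z.2)%:E < +oo)%E].

(* Lop s sigma u v is [L^s(sigma) u] v, for u and v in H^s. *)
Definition Lop (s : R) (sigma : Linf) (u v : L2) : R :=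
  \int[(lebesgue_rV \x lebesgue_rV)%E]_(z in Om `*` Om)
    ((u z.1 - u z.2) * (v z.1 - v z.2) * frac_ker s z.1 z.2
     * sigma (enorm (z.1 - z.2))).

Definition Wad (gamma1 gamma2 delta : R) : set Linf := [set sigma |
  {ae mu_itv, forall t, 0 <= sigma t <= gamma2} /\
  {ae mu_itv, forall t, t < delta -> gamma1 <= sigma t}].

Definition bounded_linear_op (S : L2 -> L2) :=
  (forall (a : R) (f g : L2),
     ae_eq mu_dom setT (S (a *: f + g)) (a *: S f + S g)) /\
  exists C : R, forall f, L2norm (S f) <= C * L2norm f.

Definition adjoint (S Sstar : L2 -> L2) :=
  forall f g, L2dot (S f) g = L2dot f (Sstar g).

Definition lower_obj s (S : L2 -> L2) (ydelta : L2) (sigma : Linf) (v : L2) : R :=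
  L2norm (S v - ydelta) ^+ 2 + Lop s sigma v v.

Definition feasible s gamma1 gamma2 delta S ydelta : set (Linf * L2) :=
  [set su | [/\ Wad gamma1 gamma2 delta su.1, Hs s su.2 &
    forall v, Hs s v ->
      lower_obj s S ydelta su.1 su.2 <= lower_obj s S ydelta su.1 v]].

Definition bilevel_obj (udag : L2) (Reg : Linf -> R) (su : Linf * L2) : R :=
  2^-1 * L2norm (su.2 - udag) ^+ 2 + Reg su.1.

Definition bilevel_solution s gamma1 gamma2 delta S ydelta udag Reg
    (su : Linf * L2) :=
  feasible s gamma1 gamma2 delta S ydelta su /\
  forall su', feasible s gamma1 gamma2 delta S ydelta su' ->
    bilevel_obj udag Reg su <= bilevel_obj udag Reg su'.

Definition ae_invariant (Reg : Linf -> R) := forall sigma1 sigma2 : Linf,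
  ae_eq mu_itv setT sigma1 sigma2 -> Reg sigma1 = Reg sigma2.

Definition gateaux_derivative (Reg : Linf -> R) (sigma : Linf) (D : Linf -> R) :=
  [/\ forall (a : R) (h k : Linf), D (a *: h + k) = a * D h + D k,
      exists C : R, forall h, `|D h| <= C * Linfnorm h &
      forall h, (Reg (sigma + t *: h) - Reg sigma) / t @[t --> 0^'] --> D h].

End spaces.

(* Main.v *)
Require Import Defs.
From HB Require Import structures.
From mathcomp Require Import all_boot all_order all_algebra.
From mathcomp Require Import all_classical all_reals all_analysis.
From mathcomp Require Import measurable_realfun.
From mathcomp Require Import ring lra.
Import Order.TTheory GRing.Theory Num.Theory.
Import numFieldNormedType.Exports.

(* Write [B_sigma(u, v) = (S u, S v) + [L^s(sigma) u] v].  Chaining cells of diameter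
   less than [delta] through the connected set [Om] gives a Poincare inequality
   involving only the pairs of points at distance less than [delta], so that
   [B_sigma] is coercive and complete on H^s, uniformly in [sigma] in [W_ad], up to
   the constants annihilated by [S].  If [S] annihilates constants, optimality of [u]
   among its shifts by constants says that [u - udag] is orthogonal to constants; so
   in every case [v |-> (u - udag, v)] is bounded for [B_sigma], and the adjoint state
   [q] is the Riesz representative of its opposite.

   For [sigma_t = sigma + t (omega - sigma)], a state is exactly [u + t z_t], where
   [B_(sigma_t)(z_t, v) = - [L^s(omega - sigma) u] v], and symmetry of the forms gives
   [(u - udag, z_t) = [L^s(omega - sigma) u] q + t [L^s(omega - sigma) q] z_t].  As
   [z_t] is bounded in L2, dividing the optimality inequality by [t] and letting
   [t] tend to [0+] yields the variational inequality; no limit of [z_t] is needed. *)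

Set Implicit Arguments.
Unset Strict Implicit.
Unset Printing Implicit Defensive.
Local Open Scope classical_set_scope.
Local Open Scope ring_scope.

(** * Semi-inner products *)

(** The obstacle is that a feasible weight may vanish at distances [delta] and beyond, and obeys its
    bounds only almost everywhere on the interval of distances. The second point requires that null
    sets of distances have null sets of pairs as preimages under [enorm (x - y)]. The first means
    that far pairs give no lower bound on the form; but the kernel is bounded at such pairs, so
    their share of the Gagliardo energy is paid for by the L2 distance of [u] to a constant, which
    near pairs control. Elements of [L2] are functions rather than classes, [S] is linear only up to
    null sets, and the form can degenerate on constants. Hence representation and completeness are
    proved for semi-inner products, without quotients: a limit or a representative is any element
    with the right values of the form, and a shift by a constant invisible to the form restores an
    L2 bound when one is needed. *)

Lemma discriminant_le (R : realFieldType) (a b c : R) :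
  (forall t, 0 <= a * t ^+ 2 + 2 * b * t + c) -> b ^+ 2 <= a * c.
Proof.
move=> H; have c0 : 0 <= c by have := H 0; rewrite expr0n/= !mulr0 !add0r.
have [a0|a0|a0] := ltgtP a 0.
- exfalso.
  (* For [t >= 1] the quadratic is at most [t] times [a t + 2 |b| + c]; this [t] makes that factor
     equal to [a - 1], which is negative. *)
  pose t := 1 + (2 * `|b| + c + 1) / (- a).
  have t1 : 1 <= t.
    by rewrite lerDl divr_ge0 ?oppr_ge0 ?(ltW a0)// !addr_ge0// mulr_ge0.
  have at_ : a * t = a - (2 * `|b| + c + 1).
    by rewrite /t; field; rewrite lt_eqF.
  have bt : 2 * b * t <= 2 * `|b| * t.
    by rewrite ler_wpM2r ?(le_trans _ t1)// ler_wpM2l// ler_norm.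
  have ct : c <= c * t by rewrite ler_peMr.
  have := H t; rewrite leNgt => /negP; apply.
  have -> : a * t ^+ 2 = (a * t) * t by rewrite expr2 mulrA.
  rewrite at_; nra.
- have := H (- b / a); rewrite -(ler_pM2l a0) mulr0.
  have -> : a * (a * (- b / a) ^+ 2 + 2 * b * (- b / a) + c) = a * c - b ^+ 2.
    by field; rewrite gt_eqF.
  by rewrite subr_ge0.
- subst a; have [->|b0] := eqVneq b 0; first by rewrite expr0n !mul0r.
  have := H (- (c + 1) / (2 * b)).
  have -> : 0 * (- (c + 1) / (2 * b)) ^+ 2 + 2 * b * (- (c + 1) / (2 * b)) + c = -1.
    by field.
  by lra.
Qed.

Lemma le0_geometric (R : realType) (x K : R) :
  (forall n, x <= K * 4 ^- n) -> x <= 0.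
Proof.
move=> H; rewrite leNgt; apply/negP => x0.
have K0 : 0 < K by have := H 0%N; rewrite expr0 invr1 mulr1; exact: lt_le_trans.
pose n := (Num.truncn (K / x)).+1.
have nK : K / x < n%:R by exact: truncnS_gt.
have n4 : n%:R <= 4 ^+ n :> R by rewrite -natrX ler_nat ltnW// ltn_expl.
have := H n; rewrite leNgt => /negP; apply.
rewrite ltr_pdivrMr ?exprn_gt0//.
by move: nK; rewrite ltr_pdivrMr// => /lt_le_trans; apply; rewrite mulrC ler_wpM2l// ltW.
Qed.

Section semi_inner_product.
Context {R : realType} {V : lmodType R} (P : set V) (B : V -> V -> R).
Hypothesis P0 : P 0.
Hypothesis PD : forall a u v, P u -> P v -> P (a *: u + v).
Hypothesis Bsym : forall u v, P u -> P v -> B u v = B v u.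
Hypothesis Blin : forall a u v w, P u -> P v -> P w ->
  B (a *: u + v) w = a * B u w + B v w.
Hypothesis Bge0 : forall u, P u -> 0 <= B u u.

Lemma form_sqrD a u v : P u -> P v ->
  B (a *: u + v) (a *: u + v) = a ^+ 2 * B u u + 2 * a * B u v + B v v.
Proof.
move=> Pu Pv; have Puv := PD a Pu Pv.
rewrite Blin// (Bsym Pu Puv) (Bsym Pv Puv) !Blin// (Bsym Pv Pu); ring.
Qed.

Lemma form_cauchy_schwarz u v : P u -> P v -> B u v ^+ 2 <= B u u * B v v.
Proof.
move=> Pu Pv; apply: discriminant_le => t.
rewrite [_ * t ^+ 2]mulrC (mulrAC 2) -form_sqrD//; exact/Bge0/PD.
Qed.

(** Completeness is asked only along geometrically decaying series, and the limit comes with a rate,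
    so no topology has to be attached to the seminorm of [B]. Limits need not be unique. *)
Hypothesis Bcomplete : forall (C : R) (d : nat -> V), (forall k, P (d k)) ->
  (forall k, B (d k) (d k) <= C * 4 ^- k) ->
  exists2 v, P v & exists C', forall n,
    B (v - \sum_(k < n) d k) (v - \sum_(k < n) d k) <= C' * 4 ^- n.

Variables (F : V -> R) (C : R).
Hypothesis Flin : forall a u v, P u -> P v -> F (a *: u + v) = a * F u + F v.
Hypothesis Fbnd : forall u, P u -> F u ^+ 2 <= C * B u u.

Let J v := B v v - 2 * F v.

Let JE t u v : P u -> P v ->
  J (t *: v + u) = J u + 2 * t * (B u v - F v) + t ^+ 2 * B v v.
Proof. by move=> Pu Pv; rewrite /J form_sqrD// Flin// (Bsym Pv Pu); ring. Qed.

Hypothesis C0 : 0 <= C.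

(** By the arithmetic-geometric inequality, [F v ^ 2 <= C B v v] is at most the square of
    [(C + B v v) / 2], so [2 F v <= C + B v v]. *)
Let J_lb v : P v -> - C <= J v.
Proof.
move=> Pv; have BC : 0 <= C + B v v by rewrite addr_ge0// Bge0.
rewrite /J leNgt; apply/negP => H.
have H2 : C + B v v < 2 * F v by lra.
have := ltr_pM BC BC H2 H2; have := sqr_ge0 (C - B v v).
have := Fbnd Pv; lra.
Qed.

(* Minimise [J v = B v v - 2 * F v]: the parallelogram identity makes a
   minimising sequence rapidly Cauchy, and near-minimality of [w n] gives
   [B (w n) v - F v = O(2 ^- n)] for every fixed [v]. *)
Theorem riesz_representation :
  exists2 q, P q & forall v, P v -> B q v = F v.
Proof.
pose E := [set J v | v in P].
have Einf : has_inf E.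
  split; first by exists (J 0); exists 0.
  by exists (- C) => _ [v Pv <-]; exact: J_lb.
have /choice[w wP] : forall n : nat, exists v, P v /\ J v <= inf E + 4 ^- n.
  move=> n; have e0 : 0 < 4 ^- n :> R by rewrite invr_gt0 exprn_gt0.
  by have [_ [v Pv <-] /ltW Jv] := inf_adherent e0 Einf; exists v.
have Jinf v : P v -> inf E <= J v.
  by move=> Pv; apply: ge_inf; [exact: Einf.2|exists v].
have wP1 n : P (w n) by have [] := wP n.
have wP2 n : J (w n) <= inf E + 4 ^- n by have [] := wP n.
pose d k := if k is k'.+1 then - 1 *: w k' + w k else w 0%N.
have Pd k : P (d k) by case: k => [|k]; [exact: wP1|exact: PD].
have dw n : \sum_(k < n.+1) d k = w n.
  elim: n => [|n IH]; first by rewrite big_ord1.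
  by rewrite big_ord_recr/= IH scaleN1r addrA subrr add0r.
(* Comparing [inf E] with [J] at the midpoint of [w k] and [w k.+1] bounds the form at [d k.+1] by
   [2 (4 ^- k + 4 ^- k.+1)], that is [10 * 4 ^- k.+1]; 16 is a convenient majorant. The other entry
   of the maximum covers the initial term [w 0]. *)
have Bd k : B (d k) (d k) <= Num.max 16 (B (w 0%N) (w 0%N)) * 4 ^- k.
  case: k => [|k] /=; first by rewrite expr0 invr1 mulr1 le_max lexx orbT.
  apply: (@le_trans _ _ (16 * 4 ^- k.+1)); last first.
    by rewrite ler_wpM2r ?invr_ge0 ?exprn_ge0// le_max lexx.
  have -> : 4 ^- k.+1 = 4^-1 * 4 ^- k :> R by rewrite exprS invfM.
  have e4 : 0 <= 4 ^- k :> R by rewrite invr_ge0 exprn_ge0.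
  have := Jinf _ (PD 2^-1 (PD (-1) (wP1 k) (wP1 k.+1)) (wP1 k)).
  have := wP2 k; have := wP2 k.+1.
  rewrite (_ : 4 ^- k.+1 = 4^-1 * 4 ^- k); last by rewrite exprS invfM.
  rewrite JE//; last exact: PD.
  rewrite /J !form_sqrD// Flin// (Bsym _ (PD _ _ _))// Blin// (Bsym (wP1 k.+1))//.
  by lra.
have [q Pq [C' qC]] := Bcomplete Pd Bd.
exists q => // v Pv; apply/eqP; rewrite -subr_eq0 -sqrf_eq0 eq_le andbC.
pose K := Num.max 0 (C' * B v v) + B v v.
have bnd n : (B q v - F v) ^+ 2 <= 2 * K * 4 ^- n.
  have e4 : 0 <= 4 ^- n :> R by rewrite invr_ge0 exprn_ge0.
  have H1 : (B (w n) v - F v) ^+ 2 <= B v v * 4 ^- n.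
    (* The quadratic is [J (t v + w n) - J (w n) + 4 ^- n], nonnegative because [w n] is within
       [4 ^- n] of the infimum. *)
    apply: discriminant_le => t.
    have := Jinf _ (PD t Pv (wP1 n)); rewrite JE//.
    by have := wP2 n; lra.
  have Pqw : P (q - w n) by rewrite -scaleN1r addrC; exact: PD.
  have H2 : B (q - w n) v ^+ 2 <= Num.max 0 (C' * B v v) * 4 ^- n.
    apply: le_trans (form_cauchy_schwarz Pqw Pv) _.
    have := qC n.+1; rewrite dw => H.
    apply: (@le_trans _ _ (C' * 4 ^- n.+1 * B v v)).
      by rewrite ler_wpM2r// Bge0.
    rewrite mulrAC; apply: (@le_trans _ _ (Num.max 0 (C' * B v v) * 4 ^- n.+1)).
      by rewrite ler_wpM2r ?invr_ge0 ?exprn_ge0// le_max lexx orbT.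
    rewrite ler_wpM2l ?le_max ?lexx// lef_pV2 ?posrE ?exprn_gt0//.
    by rewrite exprS ler_peMl ?exprn_ge0// ler1n.
  have -> : B q v = B (q - w n) v + B (w n) v.
    by have := Blin 1 Pqw (wP1 n) Pv; rewrite scale1r subrK mul1r.
  have := sqr_ge0 (B (w n) v - F v - B (q - w n) v); rewrite /K; lra.
by move: (le0_geometric bnd) => /(conj (sqr_ge0 (B q v - F v))) /andP.
Qed.

End semi_inner_product.

(** * Square-integrable functions *)

Section square_integrable.
Context d (T : measurableType d) (R : realType).
Variables (mu : {measure set T -> \bar R}) (D : set T).
Hypothesis mD : measurable D.
Implicit Types f g h : T -> R.

Definition sqint f :=
  measurable_fun D f /\ (\int[mu]_(x in D) (f x ^+ 2)%:E < +oo)%E.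

Lemma sqint_sqr f : sqint f -> mu.-integrable D (fun x => (f x ^+ 2)%:E).
Proof.
move=> [mf foo]; apply/integrableP; split.
  by apply/measurable_EFinP; exact: measurable_funX.
apply: le_lt_trans foo; rewrite le_eqVlt; apply/orP; left; apply/eqP.
by apply: eq_integral => x _; rewrite gee0_abs// lee_fin sqr_ge0.
Qed.

Lemma sqint_mul f g : sqint f -> sqint g ->
  mu.-integrable D (fun x => (f x * g x)%:E).
Proof.
move=> sf sg; have [mf _] := sf; have [mg _] := sg.
apply: (le_integrable mD _ _ (integrableD mD (sqint_sqr sf) (sqint_sqr sg))).
  by apply/measurable_EFinP; exact: measurable_funM.
move=> x _ /=; rewrite !lee_fin (ger0_norm (addr_ge0 (sqr_ge0 _) (sqr_ge0 _))).
by rewrite ler_norml; have := sqr_ge0 (f x + g x); have := sqr_ge0 (f x - g x);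
  have := sqr_ge0 (f x); have := sqr_ge0 (g x); nra.
Qed.

Lemma sqint_lin a f g : sqint f -> sqint g -> sqint (fun x => a * f x + g x).
Proof.
move=> sf sg; have [mf _] := sf; have [mg _] := sg; split.
  by apply: measurable_funD => //; exact: measurable_funM.
have i3 : mu.-integrable D
    (fun x => ((a ^+ 2)%:E * (f x ^+ 2)%:E + (2 * a)%:E * (f x * g x)%:E + (g x ^+ 2)%:E)%E).
  apply: (integrableD mD) (sqint_sqr sg).
  by apply: integrableD => //; apply: integrableZl => //; [exact: sqint_sqr|exact: sqint_mul].
apply: le_lt_trans (integrable_lty mD i3).
rewrite le_eqVlt; apply/orP; left; apply/eqP; apply: eq_integral => x _.
by rewrite -!EFinM -!EFinD; congr EFin; ring.
Qed.

Lemma Rintegral_sqr f : sqint f ->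
  ((\int[mu]_(x in D) (f x * f x))%R%:E = \int[mu]_(x in D) (f x ^+ 2)%:E)%E.
Proof.
move=> sf; rewrite fineK; first by apply: eq_integral => x _; rewrite expr2.
exact/(integrable_fin_num mD)/sqint_mul.
Qed.

End square_integrable.

(** This is Cauchy-Schwarz with weights [2 ^ i], the inverse weights having sum at most 2. The
    growth [2 ^ i] is later absorbed by terms of squared size [4 ^- i]. *)
Lemma sqr_sum_le (R : realDomainType) (a : nat -> R) n :
  (\sum_(i < n) a i) ^+ 2 <= 2 * \sum_(i < n) 2 ^+ i * a i ^+ 2.
Proof.
elim: n a => [|n IH] a; first by rewrite !big_ord0 expr0n mulr0.
rewrite !big_ord_recl expr0 mul1r /=.
pose x := \sum_(i < n) a i.+1; pose y := \sum_(i < n) 2 ^+ i * a i.+1 ^+ 2.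
have xy : x ^+ 2 <= 2 * y := IH (fun i => a i.+1).
rewrite (_ : \sum_(i < n) a _ = x)// (_ : \sum_(i < n) _ = 2 * y).
  by have := sqr_ge0 (a 0%N - x); lra.
by rewrite mulr_sumr; apply: eq_bigr => i _; rewrite mulrA -exprS.
Qed.

(** * Series with geometrically decaying L2 norms *)

Section rapid_series.
Context d (T : measurableType d) (R : realType).
Variables (mu : {measure set T -> \bar R}) (D : set T).
Hypothesis mD : measurable D.
Variables (f : nat -> T -> R) (C : R).
Hypothesis C0 : 0 <= C.
Hypothesis mf : forall k, measurable_fun D (f k).
Hypothesis fC : forall k,
  (\int[mu]_(x in D) (f k x ^+ 2)%:E <= (C * 4 ^- k)%:E)%E.

(** By [sqr_sum_le], [2 H] dominates the squares of all partial sums of [f]. Integrability of this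
    one majorant yields both the almost everywhere convergence and the L2 bound on the limit. *)
Let F k x : \bar R := (2 ^+ k * f k x ^+ 2)%:E.
Let H x := (\sum_(k <oo) F k x)%E.

Let F0 k x : (0 <= F k x)%E.
Proof. by rewrite lee_fin; apply: mulr_ge0; rewrite ?sqr_ge0 ?exprn_ge0. Qed.

Let mF k : measurable_fun D (F k).
Proof.
by apply/measurable_EFinP; apply: measurable_funM => //; exact: measurable_funX.
Qed.

Let mH : measurable_fun D H.
Proof. by apply: ge0_emeasurable_sum => // k x _ _. Qed.

Let H0 x : (0 <= H x)%E. Proof. exact: nneseries_ge0. Qed.

Let intH : (\int[mu]_(x in D) H x <= (2 * C)%:E)%E.
Proof.
rewrite integral_nneseries//.
(* The k-th integral is at most [2 ^ k * C * 4 ^- k], which is [2 C / 2 ^ k.+1]. *)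
apply: le_trans (epsilon_trick0 xpredT _); last by rewrite mulr_ge0.
apply: lee_nneseries => [k _ _|k _]; first exact: integral_ge0.
under eq_integral do rewrite /F EFinM.
rewrite ge0_integralZl_EFin//; first last.
- by apply/measurable_EFinP; exact: measurable_funX.
- by move=> x _; rewrite lee_fin sqr_ge0.
apply: (le_trans (lee_wpmul2l _ (fC k))); first by rewrite lee_fin exprn_ge0.
rewrite -EFinM lee_fin natrX exprS (_ : 4 = 2 * 2) ?exprMn; last by rewrite -natrM.
by rewrite le_eqVlt; apply/orP; left; apply/eqP; field; rewrite expf_neq0.
Qed.

Let H_ae : {ae mu, forall x, D x -> (H x < +oo)%E}.
Proof.
have iH : mu.-integrable D H.
  apply/integrableP; split => //.
  under eq_integral do rewrite gee0_abs//.
  exact: le_lt_trans intH (ltry _).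
by apply: filterS (integrable_ae mD iH) => x + Dx => /(_ Dx); rewrite ge0_fin_numE.
Qed.

Let F_le x n : (H x < +oo)%E -> \sum_(i < n) 2 ^+ i * f i x ^+ 2 <= fine (H x).
Proof.
move=> Hx; rewrite -lee_fin fineK ?ge0_fin_numE// -sumEFin.
rewrite -(big_mkord xpredT (F ^~ x)).
exact: nneseries_lim_ge.
Qed.

(** Convergence is absolute: a partial sum [z] of absolute values satisfies [z ^ 2 <= 2 H x], and
    [2 z <= z ^ 2 + 1] avoids the square root. *)
Let cvg_fin x : (H x < +oo)%E -> cvgn (series (f ^~ x)).
Proof.
move=> Hx; apply: normed_cvg; apply: nondecreasing_is_cvgn.
  by apply/nondecreasing_seqP => n; rewrite [leRHS]/series/= big_nat_recr//= lerDl.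
exists (1 + 2 * fine (H x)) => _ [n _ <-].
rewrite (_ : [normed series _] n = \sum_(i < n) `|f i x|); last exact: big_mkord.
have := sqr_sum_le (fun i => `|f i x|) n.
under [X in _ <= _ * X]eq_bigr do rewrite real_normK ?num_real//.
have := F_le n Hx; set y := \sum_(_ < _) _; set z := \sum_(_ < _) _.
have := sqr_ge0 (z - 1); have : 0 <= z by exact: sumr_ge0.
by nra.
Qed.

Lemma rapid_series_ae_cvg : {ae mu, forall x, D x -> cvgn (series (f ^~ x))}.
Proof. by apply: filterS H_ae => x + Dx => /(_ Dx); exact: cvg_fin. Qed.

(** The factor 4 is 2 from the pointwise limit [g ^ 2 <= 2 H], times 2 from the integral of [H]. *)
Lemma rapid_series_sqr_le (g : T -> R) : measurable_fun D g ->
  {ae mu, forall x, D x -> series (f ^~ x) n @[n --> \oo] --> g x} ->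
  (\int[mu]_(x in D) (g x ^+ 2)%:E <= (4 * C)%:E)%E.
Proof.
move=> mg fg; apply: (@le_trans _ _ (\int[mu]_(x in D) (2%:E * H x))%E); last first.
  rewrite ge0_integralZl//; apply: (le_trans (lee_wpmul2l _ intH)) => //.
  by rewrite -EFinM lee_fin mulrA -natrM.
apply: ae_ge0_le_integral => //.
- by move=> x _; rewrite lee_fin sqr_ge0.
- by apply/measurable_EFinP; exact: measurable_funX.
- by move=> x _; rewrite mule_ge0.
- exact: measurable_funeM.
apply: filterS2 H_ae fg => x Hx cx Dx.
have {}Hx := Hx Dx; rewrite -[H x]fineK ?ge0_fin_numE// -EFinM lee_fin.
rewrite expr2; apply: (cvgr_to_le (cvgM (cx Dx) (cx Dx))); apply: nearW => n.
have := le_trans (sqr_sum_le (f ^~ x) n) (ler_wpM2l (ler0n _ 2) (F_le n Hx)).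
by rewrite expr2 -(big_mkord xpredT (f ^~ x)).
Qed.

End rapid_series.

Section rapid_series_limit.
Context d (T : measurableType d) (R : realType).
Variables (mu : {measure set T -> \bar R}) (D : set T).

(** Elements of [L2] are measurable on the whole space, while convergence holds only almost
    everywhere on [D]. The upper limit, made real by [fine], is measurable everywhere and agrees
    with the limit where that exists. *)
Lemma ae_series_limit (f : nat -> T -> R) :
  (forall k, measurable_fun [set: T] (f k)) ->
  {ae mu, forall x, D x -> cvgn (series (f ^~ x))} ->
  exists2 g : T -> R, measurable_fun [set: T] g &
    {ae mu, forall x, D x -> series (f ^~ x) n @[n --> \oo] --> g x}.
Proof.
move=> mf cf.
exists (fun x => fine (limn_esup (fun n => (series (f ^~ x) n)%:E))).
  apply: (measurableT_comp (fine_measurable measurableT)).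
  apply: measurable_fun_limn_esup => n; apply/measurable_EFinP.
  by apply: measurable_sum => k; exact: mf.
apply: filterS cf => x + Dx => /(_ Dx) cx.
have /cvg_limn_einf_sup[_ -> /=] :
    ((series (f ^~ x) n)%:E @[n --> \oo] --> (limn (series (f ^~ x)))%:E)%E.
  by apply: cvg_EFin; [exact: nearW|exact: cx].
exact: cx.
Qed.

End rapid_series_limit.

(** * Preimages of null sets under the distance *)

Section expanding.
Context {R : realType}.
Local Notation leb := (@lebesgue_measure R).

Lemma lebesgue_measure_diameter (A : set R) (M : R) :
  measurable A -> 0 <= M -> (forall x y, A x -> A y -> `|x - y| <= M) ->
  (leb A <= (2 * M)%:E)%E.
Proof.
move=> mA M0 AM; have [->|/set0P[x Ax]] := eqVneq A set0.
  by rewrite measure0 lee_fin mulr_ge0.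
have AI : A `<=` `[x - M, x + M]%classic.
  by move=> y /(AM x y Ax); rewrite /= in_itv/= ler_norml; lra.
apply: (@le_trans _ _ (leb `[x - M, x + M]%classic)).
  by apply: le_measure => //; rewrite inE//; exact: measurable_itv.
rewrite lebesgue_measure_itv/= lte_fin; case: ifPn => _.
  by rewrite -EFinD lee_fin; lra.
by rewrite lee_fin mulr_ge0.
Qed.

(** Cover [Z] by intervals of small total length: inside [E], the preimage of an interval of length
    [l] has diameter at most [K l], hence measure at most [2 K l]. *)
Lemma expanding_preimage_null (f : R -> R) (E Z : set R) (K : R) :
  measurable_fun [set: R] f -> measurable E -> measurable Z -> 0 <= K ->
  (forall x y, E x -> E y -> `|x - y| <= K * `|f x - f y|) ->
  leb Z = 0%E -> leb (E `&` f @^-1` Z) = 0%E.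
Proof.
move=> mf mE mZ K0 fE Z0; apply/eqP; rewrite -measure_le0.
have mEf A : measurable A -> measurable (E `&` f @^-1` A).
  by move=> mA; apply: measurableI => //; rewrite -[X in measurable X]setTI; exact: mf.
apply/lee_addgt0Pr => e e0; rewrite add0e.
(* The summand 1 keeps the denominator positive when [K = 0]. *)
pose e' := e / (2 * K + 1).
have K1 : 0 < 2 * K + 1 by rewrite ltr_wpDl// mulr_ge0.
have e'0 : 0 < e' by rewrite divr_gt0.
have : (leb Z < e'%:E)%E by rewrite Z0 lte_fin.
move=> /ereal_inf_lt[_ [A [mA ZA] <-] Ae].
have mA' k : measurable (A k : set R) by apply: sub_sigma_algebra; exact: mA.
apply: (@le_trans _ _ (\sum_(0 <= k <oo) leb (E `&` f @^-1` A k))%E).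
  apply: measure_sigma_subadditive => [k||].
  - by apply: mEf; exact: mA'.
  - exact: mEf.
  - move=> x [Ex /ZA[k _ Ak]]; by exists k.
apply: (@le_trans _ _ (\sum_(0 <= k <oo) ((2 * K)%:E * wlength idfun (A k)))%E).
  apply: lee_nneseries => [//|k _].
  have [[a b] _ ab] := mA k.
  have [le_ab|lt_ba] := leP a b; last first.
    rewrite -ab/= set_itv_ge -?leNgt ?bnd_simp ?(ltW lt_ba)// preimage_set0 setI0.
    by rewrite measure0 mule_ge0// lee_fin mulr_ge0.
  rewrite -{2}ab wlength_itv_bnd// -EFinM -mulrA.
  apply: lebesgue_measure_diameter.
  - by apply: mEf; exact: mA'.
  - by rewrite mulr_ge0// subr_ge0.
  - move=> x y [Ex]; rewrite -ab/= in_itv/= => /andP[x1 x2] [Ey].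
    rewrite in_itv/= => /andP[y1 y2].
    apply: (le_trans (fE _ _ Ex Ey)); rewrite ler_wpM2l//.
    by rewrite ler_norml; apply/andP; split; lra.
rewrite nneseriesZl//.
apply: (le_trans (lee_wpmul2l _ (ltW Ae))); first by rewrite lee_fin mulr_ge0.
rewrite -EFinM lee_fin /e' mulrCA ger_pMr// ler_pdivrMr// mul1r; lra.
Qed.

(** The function is the distance to a fixed point along a coordinate line. Its slope may vanish at
    [b], so it is shown to be expanding on each half-line at distance at least [1 / (n + 1)] from
    [b]; these countably many sets miss only [b]. *)
Lemma hypot_preimage_null (b rho : R) (Z : set R) : 0 <= rho ->
  measurable Z -> leb Z = 0%E ->
  leb [set a | Z (Num.sqrt ((a - b) ^+ 2 + rho))] = 0%E.
Proof.
move=> rho0 mZ Z0; pose h a := Num.sqrt ((a - b) ^+ 2 + rho).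
have mh : measurable_fun [set: R] h.
  apply: measurableT_comp.
    by apply: continuous_measurable_fun; exact: sqrt_continuous.
  apply: measurable_funD => //; apply: measurable_funX.
  exact: measurable_funB.
pose E (e : bool) n := [set a : R | n.+1%:R^-1 <= (-1) ^+ e * (a - b)].
have mE e n : measurable (E e n).
  rewrite -[X in measurable X]setTI.
  have mg : measurable_fun [set: R] (fun a : R => (-1) ^+ e * (a - b)).
    by apply: measurable_funM => //; exact: measurable_funB.
  exact: measurable_fun_le measurableT (measurable_cst _) mg.
have Enull e n : leb (E e n `&` h @^-1` Z) = 0%E.
  pose eta : R := n.+1%:R^-1.
  have eta0 : 0 < eta by rewrite invr_gt0.
  (* Chosen so that [h ^ 2 = y ^ 2 + rho <= K y ^ 2 <= (K y) ^ 2] whenever the distance [y] to [b]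
     is at least [eta]. *)
  pose K := 1 + rho / eta ^+ 2.
  have K1 : 1 <= K by rewrite lerDl divr_ge0// sqr_ge0.
  apply: (@expanding_preimage_null h (E e n) Z K) => //; first exact: le_trans K1.
  have hE x : E e n x -> h x ^+ 2 = ((-1) ^+ e * (x - b)) ^+ 2 + rho /\
      0 <= h x <= K * ((-1) ^+ e * (x - b)).
    rewrite /E/= -/eta => ex; split.
      rewrite /h sqr_sqrtr; last by rewrite addr_ge0// sqr_ge0.
      by rewrite exprMn sqrr_sign mul1r.
    rewrite sqrtr_ge0/=.
    have x0 : 0 <= (-1) ^+ e * (x - b) by exact: le_trans (ltW eta0) ex.
    rewrite -(@ler_pXn2r _ 2)// ?nnegrE ?sqrtr_ge0//; last first.
      by rewrite mulr_ge0// (le_trans _ K1).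
    rewrite /h sqr_sqrtr; last by rewrite addr_ge0// sqr_ge0.
    have -> : (x - b) ^+ 2 = ((-1) ^+ e * (x - b)) ^+ 2.
      by rewrite exprMn sqrr_sign mul1r.
    set y := (-1) ^+ e * _ in ex x0 *; rewrite [leRHS]exprMn.
    have rK : rho = (K - 1) * eta ^+ 2.
      by rewrite /K addrAC subrr add0r divfK// expf_neq0// gt_eqF.
    have : eta ^+ 2 <= y ^+ 2 by rewrite ler_pXn2r// nnegrE ltW.
    have K0 : 0 <= K - 1 by rewrite subr_ge0.
    rewrite rK; clearbody K y eta => /(ler_wpM2l K0); have := mulr_ge0 K0 (sqr_ge0 y).
    by move=> H1 H2; have := mulr_ge0 K0 H1; lra.
  move=> x y Ex Ey; have [hx /andP[hx0 hxK]] := hE _ Ex.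
  have [hy /andP[hy0 hyK]] := hE _ Ey.
  have -> : `|x - y| = `|(-1) ^+ e * (x - b) - (-1) ^+ e * (y - b)|.
    by rewrite -mulrBr normrM normrX normrN1 expr1n mul1r; congr `|_|; ring.
  move: Ex Ey; rewrite /E/= -/eta.
  set u := (-1) ^+ e * _ in hx hxK *; set v := (-1) ^+ e * _ in hy hyK * => ux vx.
  have uv : 0 < u + v by rewrite addr_gt0// (lt_le_trans eta0).
  rewrite -(ler_pM2r uv) -{1}(gtr0_norm uv) -normrM.
  (* Squares of [h] differ from those of the distances to [b] by the same [rho]. Since
     [h x + h y <= K (u + v)], the factor [u + v] cancels. *)
  have -> : (u - v) * (u + v) = (h x - h y) * (h x + h y) by rewrite -!subr_sqr hx hy; ring.
  rewrite normrM (ger0_norm (addr_ge0 hx0 hy0)) mulrAC.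
  rewrite [leLHS]mulrC ler_wpM2r//; lra.
have mS : measurable [set a | Z (Num.sqrt ((a - b) ^+ 2 + rho))].
  by rewrite -[X in measurable X]setTI; exact: mh.
apply/(negligibleP leb mS).
apply: (@negligibleS _ _ _ leb ([set b] `|`
    (\bigcup_n (E false n `&` h @^-1` Z) `|` \bigcup_n (E true n `&` h @^-1` Z)))).
  have inv_lt (x : R) : 0 < x -> exists n, n.+1%:R^-1 <= x.
    move=> x0; exists (Num.truncn x^-1).
    by rewrite invf_ple ?posrE// ltW// truncnS_gt.
  move=> a Za; have [ab|ab|->] := ltgtP a b; [right; right|right; left|by left].
  - have /inv_lt[n nx] : 0 < b - a by rewrite subr_gt0.
    by exists n => //; split => //; rewrite /E/= expr1 mulN1r opprB.
  - have /inv_lt[n nx] : 0 < a - b by rewrite subr_gt0.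
    by exists n => //; split => //; rewrite /E/= expr0 mul1r.
have negE e n : leb.-negligible (E e n `&` h @^-1` Z).
  have mEh : measurable (E e n `&` h @^-1` Z).
    by apply: measurableI => //; rewrite -[X in measurable X]setTI; exact: mh.
  by apply/(negligibleP leb mEh); exact: Enull.
apply: negligibleU.
  by apply/(negligibleP leb (measurable_set1 b)); exact: lebesgue_measure_set1.
by apply: negligibleU; apply: negligible_bigcup => n; exact: negE.
Qed.

End expanding.

Section enorm.
Context {R : realType}.
Notation lam := (@lebesgue_rV R _).

Lemma enormN n (x : 'rV[R]_n) : enorm (- x) = enorm x.
Proof. by congr Num.sqrt; apply: eq_bigr => i _; rewrite mxE sqrrN. Qed.

Lemma enorm_gt0 n (x : 'rV[R]_n) : x != 0 -> 0 < enorm x.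
Proof.
move=> x0; rewrite sqrtr_gt0 lt_neqAle eq_sym sumr_ge0 ?andbT; last first.
  by move=> i _; exact: sqr_ge0.
apply: contra x0; rewrite psumr_eq0 => [/allP H|i _]; last exact: sqr_ge0.
apply/eqP/rowP => i; rewrite mxE; apply/eqP.
by have := H i; rewrite mem_index_enum sqrf_eq0; apply.
Qed.

Lemma ler_coord_norm n (x : 'rV[R]_n) i : `|x 0 i| <= `|x|.
Proof.
rewrite [leRHS]mx_normrE.
by apply: (@le_bigmax_cond _ _ _ _ (0, i) _ (fun k : 'I_1 * 'I_n => `|x k.1 k.2|)).
Qed.

Lemma enorm_le n (x : 'rV[R]_n) r : 0 <= r -> (forall i, `|x 0 i| <= r) ->
  enorm x <= n%:R * r.
Proof.
move=> r0 xr; have nr0 : 0 <= n%:R * r by rewrite mulr_ge0.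
rewrite -(ger0_norm nr0) -sqrtr_sqr ler_wsqrtr//.
apply: (@le_trans _ _ (n%:R * r ^+ 2)).
  rewrite mulr_natl -[X in _ *+ X]card_ord -sumr_const; apply: ler_sum => i _.
  by rewrite -real_normK ?num_real// ler_pXn2r ?nnegrE.
rewrite exprMn ler_wpM2r// ?sqr_ge0// -natrX ler_nat.
by rewrite expnS expn1; case: (n) => // k; rewrite leq_pmulr.
Qed.

Lemma measurable_enorm d (T : measurableType d) n (f : T -> 'rV[R]_n) :
  measurable_fun [set: T] f -> measurable_fun [set: T] (fun x => enorm (f x)).
Proof.
move=> mf; apply: (@measurableT_comp _ _ _ _ _ _ (@Num.sqrt R)).
  by apply: continuous_measurable_fun; exact: sqrt_continuous.
apply: measurable_sum => i; apply: measurable_funX.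
exact: (measurableT_comp (measurable_coord i)).
Qed.

Lemma measurable_enormB n :
  measurable_fun [set: 'rV[R]_n * 'rV[R]_n] (fun z => enorm (z.1 - z.2)).
Proof.
apply: measurable_enorm; apply: measurable_fun_rVP => i.
under eq_fun do rewrite !mxE.
by apply: measurable_funB; apply: (measurableT_comp (measurable_coord i)).
Qed.

Lemma enorm_rV_cons n (y : 'rV[R]_n.+1) (a : R) (v : 'rV[R]_n) :
  enorm (rV_cons (a, v) - y) = Num.sqrt ((a - y 0 ord0) ^+ 2
    + enorm (v - \row_j y 0 (lift ord0 j)) ^+ 2).
Proof.
rewrite {2}/enorm sqr_sqrtr; last by apply: sumr_ge0 => i _; exact: sqr_ge0.
have cons0 : rV_cons (a, v) 0 ord0 = a.
  by rewrite -[RHS](rV_consl (a, v) 0); congr (rV_cons _ 0 _); exact/val_inj.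
have consS i : rV_cons (a, v) 0 (lift ord0 i) = v 0 i.
  by rewrite -[RHS](rV_consr (a, v)); congr (rV_cons _ 0 _); exact/val_inj.
congr Num.sqrt; rewrite big_ord_recl; congr (_ + _).
  by rewrite mxE [(- y) _ _]mxE cons0.
by apply: eq_bigr => i _; rewrite mxE [(- y) _ _]mxE consS !mxE.
Qed.

(** By Tonelli it suffices to treat lines parallel to the first axis, where [hypot_preimage_null]
    applies with [rho] the squared distance in the other coordinates. In dimension 0 the measure is
    a point mass and the distance is constantly 0, so [Z] containing 0 would be a counterexample. *)
Lemma enorm_preimage_null n (y : 'rV[R]_n) (Z : set R) : (0 < n)%N ->
  measurable Z -> lebesgue_measure Z = 0%E ->
  lam [set x | Z (enorm (x - y))] = 0%E.
Proof.
case: n y => // n y _ mZ Z0.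
have mW : measurable [set x : 'rV[R]_n.+1 | Z (enorm (x - y))].
  rewrite -[X in measurable X]setTI.
  have mg : measurable_fun [set: 'rV[R]_n.+1] (fun x => enorm (x - y)).
    apply: measurable_enorm; apply: measurable_fun_rVP => i.
    under eq_fun do rewrite !mxE.
    by apply: measurable_funB => //; exact: measurable_coord.
  exact: mg.
rewrite /= /lebesgue_rVS /pushforward.
set A := (X in (_ \x _)%E X).
have mA : measurable A.
  by rewrite -[X in measurable X]setTI; exact: measurable_rV_cons.
have -> : (lebesgue_measure \x lebesgue_rV)%E A =
    (\int[lebesgue_rV]_v lebesgue_measure (ysection A v))%E.
  have := indic_fubini_tonelli lebesgue_measure (@lebesgue_rV R n) mA.
  by rewrite indic_fubini_tonelli_FE// indic_fubini_tonelli_GE.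
apply: integral0_eq => v _.
rewrite -[RHS](hypot_preimage_null (y 0 ord0)
  (sqr_ge0 (enorm (v - \row_j y 0 (lift ord0 j)))) mZ Z0).
congr lebesgue_measure; apply/seteqP; split => a.
  by rewrite /ysection/= inE /A/= enorm_rV_cons.
by rewrite /ysection/= inE /A/= enorm_rV_cons.
Qed.

Lemma enormB_preimage_null n (Z : set R) : (0 < n)%N ->
  measurable Z -> lebesgue_measure Z = 0%E ->
  (@lebesgue_rV R n \x @lebesgue_rV R n)%E [set z | Z (enorm (z.1 - z.2))] = 0%E.
Proof.
move=> n0 mZ Z0; apply: integral0_eq => x _ /=.
rewrite -[RHS](enorm_preimage_null x n0 mZ Z0); congr (lebesgue_rV _).
by apply/seteqP; split => y; rewrite /xsection/= inE/= -opprB enormN.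
Qed.

End enorm.

(** * Rectangles and Lebesgue measure *)

Section rectangle.
Context d1 d2 (T1 : measurableType d1) (T2 : measurableType d2) (R : realType).
Variables (m1 : {sigma_finite_measure set T1 -> \bar R}).
Variables (m2 : {sigma_finite_measure set T2 -> \bar R}).
Local Open Scope ereal_scope.

Lemma ge0_integral_rectangle (A : set T1) (B : set T2) (h : T1 * T2 -> \bar R) :
  measurable A -> measurable B ->
  measurable_fun (A `*` B) h -> (forall z, (A `*` B) z -> 0 <= h z) ->
  \int[m1 \x m2]_(z in A `*` B) h z = \int[m1]_(x in A) \int[m2]_(y in B) h (x, y).
Proof.
move=> mA mB mh h0; have mAB := measurableX mA mB.
rewrite integral_mkcond fubini_tonelli1; first last.
- by apply: erestrict_ge0.
- by apply/(measurable_restrict _ mAB measurableT); rewrite setTI.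
rewrite [RHS]integral_mkcond; apply: eq_integral => x _.
rewrite /fubini_F patchE; case: ifPn => xA.
  rewrite [RHS]integral_mkcond; apply: eq_integral => y _.
  by rewrite !patchE in_setX xA.
by apply: integral0_eq => y _; rewrite patchE in_setX (negbTE xA).
Qed.

Lemma ge0_integral_rectangle1 (A : set T1) (B : set T2) (h : T1 -> \bar R) :
  measurable A -> measurable B ->
  measurable_fun [set: T1] h -> (forall x, 0 <= h x) ->
  \int[m1 \x m2]_(z in A `*` B) h z.1 = m2 B * \int[m1]_(x in A) h x.
Proof.
move=> mA mB mh h0; rewrite ge0_integral_rectangle//; last first.
  by apply: measurable_funTS; exact: measurableT_comp.
rewrite -ge0_integralZl//; last exact: measurable_funTS.
apply: eq_integral => x _.
exact: etrans (integral_cst m2 mB (h x)) (muleC _ _).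
Qed.

Lemma ge0_integral_rectangle2 (A : set T1) (B : set T2) (h : T2 -> \bar R) :
  measurable A -> measurable B ->
  measurable_fun [set: T2] h -> (forall x, 0 <= h x) ->
  \int[m1 \x m2]_(z in A `*` B) h z.2 = m1 A * \int[m2]_(y in B) h y.
Proof.
move=> mA mB mh h0; rewrite ge0_integral_rectangle//; last first.
  by apply: measurable_funTS; exact: measurableT_comp.
exact: etrans (integral_cst m1 mA (\int[m2]_(y in B) h y)) (muleC _ _).
Qed.

Lemma ae_rectangle (A : set T1) (B : set T2) (P : T1 -> Prop) (Q : T2 -> Prop) :
  {ae m1, forall x, A x -> P x} -> {ae m2, forall y, B y -> Q y} ->
  {ae m1 \x m2, forall z, (A `*` B) z -> P z.1 /\ Q z.2}.
Proof.
move=> [N [mN N0 PN]] [M [mM M0 QM]].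
have eN : (m1 \x m2) (N `*` setT) = 0.
  apply: etrans (product_measure1E m1 m2 mN measurableT) _.
  exact: etrans (congr1 (fun t => t * m2 setT) N0) (mul0e _).
have eM : (m1 \x m2) (setT `*` M) = 0.
  apply: etrans (product_measure1E m1 m2 measurableT mM) _.
  exact: etrans (congr1 (fun t => m1 setT * t) M0) (mule0 _).
have mN' : measurable (N `*` [set: T2]) by exact: measurableX.
have mM' : measurable ([set: T1] `*` M) by exact: measurableX.
exists (N `*` setT `|` setT `*` M); split.
- exact: measurableU.
- apply: (@measure_negligible _ _ _ (m1 \x m2)); first exact: measurableU.
  by apply: negligibleU; apply/negligibleP.
- move=> [x y] /=; rewrite not_implyE not_andE => -[[Ax By] [Px|Qy]].
    by left; split => //; apply: PN => /(_ Ax).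
  by right; split => //; apply: QM => /(_ By).
Qed.

End rectangle.

Section lebesgue_sets.
Context {R : realType} {n : nat}.
Notation lam := (@lebesgue_rV R n).

Lemma measurable_box (B : 'I_n -> set R) : (forall i, measurable (B i)) ->
  measurable [set x : 'rV[R]_n | forall i, B i (x 0 i)].
Proof.
move=> mB; rewrite [X in measurable X](_ : _ =
    \big[setI/setT]_(i < n) ((fun x : 'rV[R]_n => x 0 i) @^-1` B i)).
  apply: bigsetI_measurable => i _; rewrite -[X in measurable X]setTI.
  exact: measurable_coord.
rewrite -bigcap_seq; apply/seteqP; split => x /= Bx.
  by move=> i _; exact: Bx.
by move=> i; apply: (Bx i); rewrite /= mem_index_enum.
Qed.

Lemma lebesgue_rV_bounded_lty (A : set 'rV[R]_n) :
  bounded_set A -> measurable A -> (lam A < +oo)%E.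
Proof.
move=> [M [_ HM]] mA.
have AM x : A x -> forall i, `|x 0 i| <= M + 1.
  by move=> Ax i; apply: le_trans (ler_coord_norm x i) (HM _ _ _ Ax); rewrite ltrDl.
pose I (i : 'I_n) : set R := `[- (M + 1), M + 1]%classic.
have mI i : measurable (I i) by exact: measurable_itv.
apply: (@le_lt_trans _ _ (lam [set x | forall i, I i (x 0 i)])).
  apply: le_measure; rewrite ?inE//; first exact: measurable_box.
  by move=> x Ax i; rewrite /I/= in_itv/= -ler_norml; exact: AM.
rewrite lebesgue_rV_box//.
suff : (\prod_(i < n) lebesgue_measure (I i))%E \is a fin_num by rewrite ltey_eq => ->.
apply: prode_fin_num => i _; rewrite /I lebesgue_measure_itv/=.
by case: ifPn => // _; rewrite -EFinD.
Qed.

Lemma lebesgue_rV_open_gt0 (A : set 'rV[R]_n) : open A -> A !=set0 ->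
  (0 < lam A)%E.
Proof.
move=> oA [x Ax].
have /nbhs_ballP[e /= e0 xeA] : nbhs x A by exact: open_nbhs_nbhs.
pose I (i : 'I_n) : set R := ball (x 0 i) e.
have mI i : measurable (I i) by exact: measurable_ball.
apply: (@lt_le_trans _ _ (lam [set y | forall i, I i (y 0 i)])).
  rewrite lebesgue_rV_box//; elim/big_ind : _ => // [a b a0 b0|i _].
    by rewrite mule_gt0.
  rewrite /I lebesgue_measure_ball ?ltW// lte_fin.
  by rewrite mulr2n addr_gt0.
apply: le_measure; rewrite ?inE//.
- exact: measurable_box.
- exact: open_measurable_rV.
- by move=> y Iy; apply: xeA; split => // i j; rewrite (ord1 i); exact: Iy.
Qed.

End lebesgue_sets.

(** * A nonlocal Poincare inequality *)

Section oscillation.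
Context d (T : measurableType d) (R : realType).
Variable m : {sigma_finite_measure set T -> \bar R}.
Implicit Types (A B : set T) (v : T -> R) (c : R).

Lemma measurable_sqr_shift v c : measurable_fun [set: T] v ->
  measurable_fun [set: T] (fun x => ((v x - c) ^+ 2)%:E).
Proof.
move=> mv; apply/measurable_EFinP; apply: measurable_funX.
exact: measurable_funB.
Qed.

Lemma measurable_sqr_diff v : measurable_fun [set: T] v ->
  measurable_fun [set: T * T] (fun z => ((v z.1 - v z.2) ^+ 2)%:E).
Proof.
move=> mv; apply/measurable_EFinP; apply: measurable_funX.
by apply: measurable_funB; exact: measurableT_comp.
Qed.

(** Integrate [(v y - c) ^ 2 <= 2 (v x - v y) ^ 2 + 2 (v x - c) ^ 2] over [x] in [A] and [y] in [B]:
    closeness to [c] passes from [A] to [B]. *)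
Lemma oscillation_chain A B v c : measurable A -> measurable B ->
  measurable_fun [set: T] v ->
  (m A * \int[m]_(x in B) ((v x - c) ^+ 2)%:E <=
   2%:E * \int[m \x m]_(z in A `*` B) ((v z.1 - v z.2) ^+ 2)%:E +
   2%:E * (m B * \int[m]_(x in A) ((v x - c) ^+ 2)%:E))%E.
Proof.
move=> mA mB mv; have mAB := measurableX mA mB.
have sq0 (r : R) : (0 <= (r ^+ 2)%:E)%E by rewrite lee_fin sqr_ge0.
rewrite -(ge0_integral_rectangle2 m m mA mB (measurable_sqr_shift c mv))//.
rewrite -(ge0_integral_rectangle1 m m mA mB (measurable_sqr_shift c mv))//.
have m1 : measurable_fun (A `*` B) (fun z => ((v z.1 - v z.2) ^+ 2)%:E).
  by apply: measurable_funTS; exact: measurable_sqr_diff.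
have m2 : measurable_fun (A `*` B) (fun z : T * T => ((v z.1 - c) ^+ 2)%:E).
  by apply: measurable_funTS; apply: (measurableT_comp (measurable_sqr_shift c mv)).
rewrite -!ge0_integralZl// -ge0_integralD//; first last.
- exact: measurable_funeM.
- by move=> z _; rewrite mule_ge0.
- exact: measurable_funeM.
- by move=> z _; rewrite mule_ge0.
apply: ge0_le_integral => //.
- by apply: measurable_funTS; apply: (measurableT_comp (measurable_sqr_shift c mv)).
- by apply: emeasurable_funD; exact: measurable_funeM.
- move=> z _; rewrite -!EFinM -EFinD lee_fin.
  by have := sqr_ge0 ((v z.1 - v z.2) + (v z.1 - c)); lra.
Qed.

(* [c] is the mean value of [v] over [A]. *)
Lemma oscillation_mean A v : measurable A -> (0 < m A < +oo)%E ->
  measurable_fun [set: T] v -> (\int[m]_(x in A) (v x ^+ 2)%:E < +oo)%E ->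
  exists c, (m A * \int[m]_(x in A) ((v x - c) ^+ 2)%:E <=
    \int[m \x m]_(z in A `*` A) ((v z.1 - v z.2) ^+ 2)%:E)%E.
Proof.
move=> mA /andP[A0 Aoo] mv v2.
have mAfin : m A \is a fin_num by rewrite ge0_fin_numE.
set a := fine (m A); have a0 : 0 < a by rewrite fine_gt0// A0.
have am : m A = a%:E by rewrite fineK.
have icst r : (\int[m]_(x in A) r%:E = (r * a)%:E)%E.
  apply: etrans (integral_cst m mA r%:E) _.
  by rewrite EFinM; congr (_ * _)%E; exact: am.
have sv : sqint m A v by split => //; exact: measurable_funTS.
have sc (c : R) : sqint m A (cst c).
  split; first exact: measurable_cst.
  by apply: le_lt_trans (ltry (c ^+ 2 * a)); rewrite -icst.
have iv : m.-integrable A (EFin \o v).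
  have := sqint_mul mA sv (sc 1).
  by apply: eq_integrable => // x _ /=; rewrite mulr1.
pose I := \int[m]_(x in A) v x; pose c := I / a.
have IE : (\int[m]_(x in A) (v x)%:E)%E = I%:E.
  by rewrite fineK//; exact: integrable_fin_num.
exists c; rewrite am -ge0_integralZl//; first last.
- by rewrite lee_fin ltW.
- by move=> x _; rewrite lee_fin sqr_ge0.
- by apply: measurable_funTS; exact: measurable_sqr_shift.
rewrite ge0_integral_rectangle//; first last.
- by move=> z _; rewrite lee_fin sqr_ge0.
- by apply: measurable_funTS; exact: measurable_sqr_diff.
apply: ge0_le_integral => //.
- by move=> x _; rewrite mule_ge0 ?lee_fin ?sqr_ge0// ltW.
- by apply: measurable_funeM; apply: measurable_funTS; exact: measurable_sqr_shift.
- apply: measurable_funTS.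
  pose h := (fun z : T * T => ((v z.1 - v z.2) ^+ 2)%:E) \_ (setT `*` A).
  have mTA : measurable ([set: T] `*` A) by exact: measurableX.
  have mh : measurable_fun [set: T * T] h.
    apply/(measurable_restrict _ mTA measurableT).
    by apply: measurable_funTS; exact: measurable_sqr_diff.
  have h0 z : (0 <= h z)%E.
    by apply: erestrict_ge0 => {}z _; rewrite lee_fin sqr_ge0.
  rewrite (_ : (fun x => _) = fubini_F m h).
    exact: measurable_fun_fubini_tonelli_F.
  apply/funext => x; apply/esym.
  rewrite /fubini_F [RHS]integral_mkcond; apply: eq_integral => y _.
  by rewrite /h !patchE in_setX in_setT.
move=> x _ /=.
have lin k l : (\int[m]_(y in A) (k + l * v y)%:E = (k * a + l * I)%:E)%E.
  transitivity (\int[m]_(y in A) ((cst k y)%:E + l%:E * (v y)%:E))%E.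
    by apply: eq_integral => y _; rewrite -EFinM -EFinD.
  rewrite integralD//; first last.
  - exact: integrableZl.
  - have := sqint_mul mA (sc k) (sc 1).
    by apply: eq_integrable => // y _ /=; rewrite mulr1.
  rewrite integralZl// IE EFinD EFinM; congr (_ + _)%E; exact: icst.
have ca : c * a = I by rewrite /c divfK// gt_eqF.
(* The integrand is [(v x - v y) ^ 2] without its term [(c - v y) ^ 2]; the cross term
   [2 (v x - c) (c - v y)] integrates to 0 because [c] is the mean. *)
have -> : (a%:E * ((v x - c) ^+ 2)%:E = \int[m]_(y in A)
    (((v x - c) ^+ 2 + 2 * (v x - c) * c) + (- (2 * (v x - c))) * v y)%:E)%E.
  by rewrite lin -EFinM -ca; congr EFin; ring.
apply: le_integral => //.
- have := sqint_lin mA (- (2 * (v x - c))) sv (sc ((v x - c) ^+ 2 + 2 * (v x - c) * c)).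
  move=> /(sqint_mul mA) => /(_ _ (sc 1)).
  by apply: eq_integrable => // y _ /=; rewrite mulr1 addrC.
- have /sqint_sqr := sqint_lin mA (-1) sv (sc (v x)).
  by apply: eq_integrable => // y _ /=; congr EFin; ring.
- by move=> y _; rewrite lee_fin; have := sqr_ge0 (c - v y); lra.
Qed.

End oscillation.

Section poincare.
Context {R : realType} {n : nat} (Om : set 'rV[R]_n) (delta : R).
Hypotheses (Om_neq0 : Om !=set0) (oOm : open Om) (cOm : connected Om).
Hypotheses (bOm : bounded_set Om) (delta_gt0 : 0 < delta).
Notation lam := (@lebesgue_rV R n).

Definition near_pairs : set ('rV[R]_n * 'rV[R]_n) :=
  [set z | (Om `*` Om) z /\ enorm (z.1 - z.2) < delta].

(** Neither kernel nor weight appears: on near pairs both are bounded below, so this quantity is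
    controlled by the form of every feasible weight. *)
Definition near_energy (v : 'rV[R]_n -> R) : \bar R :=
  (\int[(lam \x lam)%E]_(z in near_pairs) ((v z.1 - v z.2) ^+ 2)%:E)%E.

Let mOm : measurable Om. Proof. exact: open_measurable_rV. Qed.

Lemma measurable_near_pairs : measurable near_pairs.
Proof.
have mf : measurable_fun (Om `*` Om) (fun z : _ * 'rV[R]_n => enorm (z.1 - z.2)).
  by apply: measurable_funTS; exact: measurable_enormB.
have := mf (measurableX mOm mOm) `]-oo, delta[%classic (measurable_itv _).
congr measurable; apply/seteqP; split => z [Oz] /=; rewrite in_itv/=.
Qed.

(** Balls are for the sup norm. Points of the cells of two centres less than [rho] apart differ by
    less than [3 rho] in each coordinate, so their Euclidean distance is at most [3 n rho], below
    [delta]. *)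
Let rho := delta / (4 * n.+1%:R).

Let rho_gt0 : 0 < rho. Proof. by rewrite divr_gt0// mulr_gt0. Qed.

Let cell x : set 'rV[R]_n := ball x rho `&` Om.

Let cell_open x : open (cell x).
Proof. by apply: openI => //; exact: ball_open. Qed.

Let mcell x : measurable (cell x).
Proof. exact: open_measurable_rV. Qed.

Let cell_gt0 x : Om x -> (0 < lam (cell x))%E.
Proof.
move=> Ox; apply: lebesgue_rV_open_gt0 => //; exists x; split => //.
exact: ballxx.
Qed.

Let Om_fin : (lam Om < +oo)%E.
Proof. exact: lebesgue_rV_bounded_lty. Qed.

Let cell_fin x : (lam (cell x) < +oo)%E.
Proof. by apply: le_lt_trans Om_fin; apply: le_measure; rewrite ?inE// => y []. Qed.

Let cell_near x y : ball x rho y -> cell x `*` cell y `<=` near_pairs.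
Proof.
move=> [_ xy] [a b] [[/= [_ xa] Oa] [/= [_ yb] Ob]]; split => //=.
apply: (@le_lt_trans _ _ (n%:R * (3 * rho))).
  apply: enorm_le => [|i]; first by rewrite mulr_ge0// ltW.
  have := xy 0 i; have := xa 0 i; have := yb 0 i.
  rewrite /ball/= !mxE => y1 x1 xy1.
  have -> : a 0 i - b 0 i = (x 0 i - y 0 i) + (y 0 i - b 0 i) - (x 0 i - a 0 i) by ring.
  apply: (le_trans (ler_normB _ _)); apply: (le_trans (lerD (ler_normD _ _) (lexx _))).
  by lra.
rewrite /rho; have -> : n%:R * (3 * (delta / (4 * n.+1%:R))) =
    delta * (3 / 4 * (n%:R / n.+1%:R)) :> R.
  by field; rewrite addrC natr1 pnatr_eq0.
rewrite gtr_pMr//; have : n%:R / n.+1%:R <= 1 :> R.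
  by rewrite ler_pdivrMr// mul1r ler_nat.
have : 0 <= n%:R / n.+1%:R :> R by rewrite divr_ge0.
by move: (n%:R / n.+1%:R) => t; lra.
Qed.

(* Deviations of [v] are measured from its mean value [c] over a fixed cell [A0]. *)
Let controlled (A0 A : set 'rV[R]_n) := exists2 C : R, 0 <= C &
  forall (v : 'rV[R]_n -> R) (c : R), measurable_fun [set: 'rV[R]_n] v ->
    (lam A0 * \int[lam]_(x in A0) ((v x - c) ^+ 2)%:E <= near_energy v)%E ->
    (\int[lam]_(x in A) ((v x - c) ^+ 2)%:E <= C%:E * near_energy v)%E.

Let near_le A (v : 'rV[R]_n -> R) : measurable_fun [set: 'rV[R]_n] v -> measurable A ->
  A `<=` near_pairs ->
  (\int[(lam \x lam)%E]_(z in A) ((v z.1 - v z.2) ^+ 2)%:E <= near_energy v)%E.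
Proof.
move=> mv mA AN; apply: ge0_subset_integral => //.
- exact: measurable_near_pairs.
- by apply: measurable_funTS; exact: measurable_sqr_diff.
- by move=> z _; rewrite lee_fin sqr_ge0.
Qed.

Let fin_cell x : lam (cell x) = (fine (lam (cell x)))%:E.
Proof. by rewrite fineK// ge0_fin_numE// cell_fin. Qed.

Let controlled_refl x : Om x -> controlled (cell x) (cell x).
Proof.
move=> Ox; have a0 : 0 < fine (lam (cell x)) by rewrite fine_gt0// cell_gt0//= cell_fin.
exists (fine (lam (cell x)))^-1; first by rewrite invr_ge0 ltW.
by move=> v c mv; rewrite fin_cell lee_pdivlMl.
Qed.

(** With [a] and [b] the measures of the two cells, [oscillation_chain] bounds [a] times the new
    integral by [2 + 2 b C] times the energy; [a] is positive because the cell of [x] is open and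
    contains [x]. *)
Let controlled_step A0 x y : Om x -> ball x rho y ->
  controlled A0 (cell x) -> controlled A0 (cell y).
Proof.
move=> Ox xy [C C0 AC].
set a := fine (lam (cell x)); set b := fine (lam (cell y)).
have a0 : 0 < a by rewrite fine_gt0// cell_gt0//= cell_fin.
have b0 : 0 <= b by exact: fine_ge0.
exists (a^-1 * (2 + 2 * b * C)).
  by rewrite mulr_ge0 ?invr_ge0 ?(ltW a0)// addr_ge0// !mulr_ge0.
move=> v c mv vc; have {}AC := AC v c mv vc.
rewrite EFinM -muleA lee_pdivlMl//.
have := oscillation_chain lam c (mcell x) (mcell y) mv.
rewrite (fin_cell x) (fin_cell y) -/a -/b => /le_trans; apply.
have -> : ((2 + 2 * b * C)%:E * near_energy v =
    2%:E * near_energy v + (2 * b * C)%:E * near_energy v)%E.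
  by rewrite [in LHS]EFinD ge0_muleDl ?lee_fin// !mulr_ge0.
apply: leeD.
  apply: lee_wpmul2l => //; apply: near_le => //; first exact: measurableX.
  exact: cell_near.
rewrite -mulrA EFinM -muleA; apply: lee_wpmul2l => //.
rewrite EFinM -muleA; apply: lee_wpmul2l => //.
Qed.

Let controlledS A0 A B : measurable A -> measurable B -> A `<=` B ->
  controlled A0 B -> controlled A0 A.
Proof.
move=> mA mB AB [C C0 BC]; exists C => // v c mv vc.
apply: le_trans (BC v c mv vc); apply: ge0_subset_integral => //.
- by apply: measurable_funTS; exact: measurable_sqr_shift.
- by move=> z _; rewrite lee_fin sqr_ge0.
Qed.

Let controlledU A0 A B : measurable A -> measurable B ->
  controlled A0 A -> controlled A0 B -> controlled A0 (A `|` B).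
Proof.
move=> mA mB AC BC.
have [D D0 {}BC] : controlled A0 (B `\` A).
  exact: controlledS (measurableD mB mA) mB (@subDsetl _ _ _) BC.
have [C C0 {}AC] := AC.
exists (C + D); first exact: addr_ge0.
move=> v c mv vc; have -> : A `|` B = A `|` (B `\` A).
  apply/seteqP; split => x; last by case=> [|[]]; [left|right].
  by have [|nAx] := pselect (A x); [left|case=> //; right].
rewrite ge0_integral_setU//; first last.
- by rewrite disj_set2E; apply/eqP; rewrite setDE setICA setICr setI0.
- by move=> x _; rewrite lee_fin sqr_ge0.
- by apply: measurable_funTS; exact: measurable_sqr_shift.
- exact: measurableD.
rewrite EFinD ge0_muleDl ?lee_fin//; apply: leeD; [exact: AC|exact: BC].
Qed.

Theorem poincare_near : exists2 C : R, 0 <= C &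
  forall v : 'rV[R]_n -> R, measurable_fun [set: 'rV[R]_n] v ->
    (\int[lam]_(x in Om) (v x ^+ 2)%:E < +oo)%E ->
    exists c, (\int[lam]_(x in Om) ((v x - c) ^+ 2)%:E <= C%:E * near_energy v)%E.
Proof.
have [x0 Ox0] := Om_neq0.
(* By [controlled_step], membership in [G] spreads to all points of [Om] within the fixed radius
   [rho]. So [G] is both relatively open and relatively closed, and connectedness makes it all of
   [Om]. *)
pose G := [set x | Om x /\ controlled (cell x0) (cell x)].
have GOm : G = Om.
  apply: cOm.
  - by exists x0; split => //; exact: controlled_refl.
  - exists (\bigcup_(x in G) ball x rho); first by apply: bigcup_open => x _; exact: ball_open.
    apply/seteqP; split => [x Gx|y [Oy [x [Ox Cx] xy]]].
      by split; [exact: Gx.1|exists x => //; exact: ballxx].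
    split; first exact: Oy.
    have := controlled_step Ox xy Cx.
    by apply.
  - exists (closure G); first exact: closed_closure.
    apply/seteqP; split => [x Gx|y [Oy]].
      by split; [exact: Gx.1|exact: subset_closure].
    move=> /(_ _ (nbhsx_ballx y rho rho_gt0)) [x [[Ox Cx] /ball_sym yx]].
    split; first exact: Oy.
    have := controlled_step Ox yx Cx.
    by apply.
(* Compactness leaves finitely many cells to add up. The closure is covered by balls centred in [Om]
   itself, whose cells are the controlled ones. *)
have cptOm : compact (closure Om).
  apply: bounded_closed_compact; last exact: closed_closure.
  have [M [Mr HM]] := bOm; exists M; split=> // y My x xO.
  suff : Om `<=` [set z | `|z| <= y].
    move=> /closure_subset /(_ _ xO).
    have cl : closed [set z : 'rV[R]_n | `|z| <= y].
      apply: (@closed_comp _ _ (fun z : 'rV[R]_n => `|z|) [set r | r <= y]).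
        by move=> z _; exact: norm_continuous.
      exact: closed_le.
    by rewrite -(proj1 (closure_id _) cl).
  by move=> z; exact: HM.
move: cptOm; rewrite compact_cover => cptOm.
have [|D DOm OmD] := cptOm _ Om (fun x => ball x rho) (fun x _ => ball_open x rho).
  move=> y yO; have [x [Ox yx]] := yO _ (nbhsx_ballx y rho rho_gt0).
  by exists x => //; exact: ball_sym.
have COm : controlled (cell x0) Om.
  have {}OmD : Om `<=` \big[setU/set0]_(x <- finmap.enum_fset D) cell x.
    move=> y Oy; have [x /= Dx xy] := OmD _ (subset_closure Oy).
    by rewrite -bigcup_seq; exists x.
  have GD x : x \in finmap.enum_fset D -> G x by move=> /DOm; rewrite inE GOm.
  move: (finmap.enum_fset D) OmD GD => s OmD GD.
  suff [mU CU] : measurable (\big[setU/set0]_(x <- s) cell x) /\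
      controlled (cell x0) (\big[setU/set0]_(x <- s) cell x).
    exact: controlledS OmD CU.
  elim: s GD {OmD} => [|x s IH] GD.
    rewrite big_nil; split => //; exists 0 => // v c mv _.
    by rewrite integral_set0 mul0e.
  rewrite big_cons; have [y|mU CU] := IH; first by move=> ys; apply: GD; rewrite inE ys orbT.
  split; first exact: measurableU.
  apply: controlledU => //.
  by have [] := GD x; rewrite ?inE ?eqxx.
have [C C0 {}COm] := COm; exists C => // v mv v2.
have l0 : (0 < lam (cell x0) < +oo)%E by rewrite cell_gt0// cell_fin.
have v2' : (\int[lam]_(x in cell x0) (v x ^+ 2)%:E < +oo)%E.
  apply: le_lt_trans v2; apply: ge0_subset_integral => //.
  - by apply: measurable_funTS; apply/measurable_EFinP; exact: measurable_funX.
  - by move=> z _; rewrite lee_fin sqr_ge0.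
  - by move=> z [].
have [c cP] := oscillation_mean (mcell x0) l0 mv v2'.
exists c; apply: (COm v c mv); apply: le_trans cP _.
apply: near_le => //; first exact: measurableX.
by apply: cell_near; exact: ballxx.
Qed.

End poincare.

(** * The spaces L2 and H^s, and the form of L^s(sigma) *)

Section restriction.
Context d (T : measurableType d) (R : realType).
Variables (mu : {measure set T -> \bar R}) (D : set T) (mD : measurable D).

Lemma ge0_integral_mrestr (f : T -> \bar R) :
  measurable_fun [set: T] f -> (forall x, (0 <= f x)%E) ->
  (\int[mrestr mu mD]_x f x = \int[mu]_(x in D) f x)%E.
Proof.
move=> mf f0.
have D0 : mrestr mu mD (~` D) = 0%E by rewrite /mrestr setICl measure0.
have mDC : measurable (~` D) by exact: measurableC.
rewrite (ge0_negligible_integral mDC measurableT mf (fun x _ => f0 x) D0).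
rewrite setTD setCK; apply: eq_measure_integral => A mA AD.
by rewrite /= /mrestr (setIidl AD).
Qed.

Lemma ae_mrestr (P : T -> Prop) :
  {ae mrestr mu mD, forall x, P x} -> {ae mu, forall x, D x -> P x}.
Proof.
move=> [N [mN N0 PN]]; exists (N `&` D); split => //; first exact: measurableI.
by move=> x /=; rewrite not_implyE => -[Dx Px]; split => //; exact: PN.
Qed.

End restriction.

Lemma Lfun_linE d (T : measurableType d) (R : realType)
    (mu : {measure set T -> \bar R}) (p : \bar R) (p1 : (1 <= p)%E)
    (a : R) (f g : LfunType mu p1) x :
  (a *: f + g : LfunType mu p1) x = a * f x + g x.
Proof. by []. Qed.

Section L2_facts.
Context {R : realType} {N : nat} (Om : set 'rV[R]_N) (oOm : open Om).
Notation lam := (@lebesgue_rV R N).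
Implicit Types u v w : L2 oOm.

Let mOm : measurable Om. Proof. exact: open_measurable_rV. Qed.

Lemma L2_measurable u : measurable_fun [set: 'rV[R]_N] u.
Proof. exact: measurable_funPT. Qed.

Let L2_normE (f : 'rV[R]_N -> R) : measurable_fun [set: 'rV[R]_N] f ->
  ('N[mu_dom oOm]_2%:E[EFin \o f] `^ 2 = \int[lam]_(x in Om) (f x ^+ 2)%:E)%E.
Proof.
move=> mf; rewrite powR_Lnorm//.
under eq_integral do rewrite /= ?poweR_EFin powR_mulrn// real_normK ?num_real//.
apply: ge0_integral_mrestr => [|x]; last by rewrite lee_fin sqr_ge0.
by apply/measurable_EFinP; exact: measurable_funX.
Qed.

Lemma L2_sqint u : sqint lam Om u.
Proof.
split; first by apply: measurable_funTS; exact: L2_measurable.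
rewrite -L2_normE; last exact: L2_measurable.
by apply: poweR_lty; exact: Lfunction_finite.
Qed.

Lemma L2dotE u : ((L2dot u u)%:E = \int[lam]_(x in Om) (u x ^+ 2)%:E)%E.
Proof. exact: (Rintegral_sqr mOm (L2_sqint u)). Qed.

Lemma L2norm_sqr u : L2norm u ^+ 2 = L2dot u u.
Proof.
apply: EFin_inj; rewrite L2dotE -L2_normE; last exact: L2_measurable.
rewrite /L2norm -finite_norm_fine poweR_EFin powR_mulrn//.
by rewrite fine_ge0// Lnorm_ge0.
Qed.

Lemma L2_ofP (f : 'rV[R]_N -> R) : measurable_fun [set: 'rV[R]_N] f ->
  (\int[lam]_(x in Om) (f x ^+ 2)%:E < +oo)%E ->
  exists u : L2 oOm, f = u :> ('rV[R]_N -> R).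
Proof.
move=> mf f2.
have fL : f \in Lfun (mu_dom oOm) 2%:E.
  rewrite inE; apply/andP; split; rewrite inE//=.
  apply: (@lty_poweRy _ _ 2) => //.
  by rewrite L2_normE.
by exists (Lfun_Sub (lee1n 2) fL).
Qed.

Lemma L2dotC u v : L2dot u v = L2dot v u.
Proof. by apply: eq_Rintegral => x _; rewrite mulrC. Qed.

Lemma L2dot_lin a u v w : L2dot (a *: u + v) w = a * L2dot u w + L2dot v w.
Proof.
have iuw := sqint_mul mOm (L2_sqint u) (L2_sqint w).
have ivw := sqint_mul mOm (L2_sqint v) (L2_sqint w).
rewrite /L2dot -RintegralZl// -RintegralD//; last first.
  by rewrite /comp; under eq_fun do rewrite EFinM; exact: integrableZl.
by apply: eq_Rintegral => x _; rewrite mulrDl -mulrA.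
Qed.

Lemma L2dot_ge0 u : 0 <= L2dot u u.
Proof. by rewrite -L2norm_sqr sqr_ge0. Qed.

Lemma L2dot_ae u v w : ae_eq (mu_dom oOm) setT u v -> L2dot u w = L2dot v w.
Proof.
move=> /ae_mrestr uv; congr fine; apply: ae_eq_integral => //.
- exact: (measurable_int _ (sqint_mul mOm (L2_sqint u) (L2_sqint w))).
- exact: (measurable_int _ (sqint_mul mOm (L2_sqint v) (L2_sqint w))).
- by apply: filterS uv => x + Ox => /(_ Ox) /(_ I) ->.
Qed.

End L2_facts.

(** * From distances to pairs of points *)

Section weights.
Context {R : realType} {N : nat} (Om : set 'rV[R]_N).
Hypotheses (N_gt0 : (0 < N)%N) (bOm : bounded_set Om).
Notation lam := (@lebesgue_rV R N).

Lemma enormB_le_diam (x y : 'rV[R]_N) : Om x -> Om y -> enorm (x - y) <= diam Om.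
Proof.
move=> Ox Oy; apply: ub_le_sup; last by exists x => //; exists y.
have [M [_ HM]] := bOm; have {}HM z : Om z -> `|z| <= `|M| + 1.
  by apply: HM; rewrite (le_lt_trans (ler_norm M))// ltrDl.
have M0 : 0 <= `|M| + 1 by rewrite addr_ge0.
exists (N%:R * (2 * (`|M| + 1))) => _ [a Oa [b Ob <-]].
apply: enorm_le => [|i]; first by rewrite mulr_ge0.
rewrite !mxE (le_trans (ler_normB _ _))// mulr_natl mulr2n.
by apply: lerD; apply: le_trans (ler_coord_norm _ _) (HM _ _).
Qed.

(* The bounds defining W_ad hold almost everywhere on ]0, diam Om[ only; this
   transfers them to almost every pair of points. *)
Lemma ae_mu_itv_pairs (P : R -> Prop) : {ae mu_itv Om, forall t, P t} ->
  {ae (lam \x lam)%E, forall z, (Om `*` Om) z -> z.1 <> z.2 -> P (enorm (z.1 - z.2))}.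
Proof.
move=> /ae_mrestr[Z [mZ Z0 PZ]].
(* Only [enorm (x - y) <= diam Om] is known, and the open interval omits its right end, so the value
   [diam Om] joins the null set. *)
have mZ' : measurable (Z `|` [set diam Om]) by apply: measurableU.
have Z'0 : lebesgue_measure (Z `|` [set diam Om]) = 0%E.
  apply/(negligibleP lebesgue_measure mZ').
  apply: negligibleU; first exact/(negligibleP lebesgue_measure mZ).
  apply/(negligibleP lebesgue_measure (measurable_set1 _)).
  exact: lebesgue_measure_set1.
exists [set z | (Z `|` [set diam Om]) (enorm (z.1 - z.2))]; split.
- rewrite -[X in measurable X]setTI.
  by apply: (@measurable_enormB R N measurableT).
- exact: enormB_preimage_null.
- move=> [x y] /= /not_implyP[[/= Ox Oy]] /not_implyP[xy nP].
  have := enormB_le_diam Ox Oy; rewrite le_eqVlt => /predU1P[->|lt_d]; first by right.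
  left; apply: PZ => /=; apply/not_implyP; split => //=.
  rewrite in_itv/= lt_d andbT enorm_gt0// subr_eq0; exact/eqP.
Qed.

End weights.

Section nonlocal_form.
Context {R : realType} {N : nat} (Om : set 'rV[R]_N).
Hypotheses (N_gt0 : (0 < N)%N) (oOm : open Om) (bOm : bounded_set Om).
Variables (s gamma1 gamma2 delta : R).
Hypotheses (gamma1_gt0 : 0 < gamma1) (gamma12 : gamma1 <= gamma2).
Notation lam := (@lebesgue_rV R N).
Notation lam2 := (lam \x lam)%E.
Notation Om2 := (Om `*` Om).
Implicit Types (u v w : L2 oOm) (sigma : Linf Om).

Let mOm : measurable Om. Proof. exact: open_measurable_rV. Qed.
Let mOm2 : measurable Om2. Proof. exact: measurableX. Qed.

(* H^s consists of the [u] with [gag u] square-integrable over [Om * Om], and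
   [L^s(sigma)] integrates [gag u * gag v * sigma]. *)
Definition gag (u : 'rV[R]_N -> R) (z : 'rV[R]_N * 'rV[R]_N) : R :=
  (u z.1 - u z.2) * Num.sqrt (frac_ker s z.1 z.2).

Lemma frac_ker_ge0 (x y : 'rV[R]_N) : 0 <= frac_ker s x y.
Proof. by rewrite invr_ge0 powR_ge0. Qed.

Lemma gagM u v z :
  gag u z * gag v z = (u z.1 - u z.2) * (v z.1 - v z.2) * frac_ker s z.1 z.2.
Proof. by rewrite /gag mulrACA -expr2 sqr_sqrtr ?frac_ker_ge0. Qed.

Lemma gag_sqr u z : gag u z ^+ 2 = (u z.1 - u z.2) ^+ 2 * frac_ker s z.1 z.2.
Proof. by rewrite expr2 gagM -expr2. Qed.

Lemma measurable_gag (u : 'rV[R]_N -> R) : measurable_fun [set: 'rV[R]_N] u ->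
  measurable_fun [set: 'rV[R]_N * 'rV[R]_N] (gag u).
Proof.
move=> mu; apply: measurable_funM.
  by apply: measurable_funB; exact: measurableT_comp.
apply: (@measurableT_comp _ _ _ _ _ _ (@Num.sqrt R)).
  by apply: continuous_measurable_fun; exact: sqrt_continuous.
rewrite (_ : (fun _ => _) = (fun z => enorm (z.1 - z.2) `^ (- (N%:R + 2 * s)))).
  apply: (measurableT_comp (measurable_powR _)); exact: measurable_enormB.
by apply/funext => z; rewrite powRN.
Qed.

Lemma Hs_sqint u : Hs s u <-> sqint lam2 Om2 (gag u).
Proof.
have E : (\int[lam2]_(z in Om2) (gag u z ^+ 2)%:E =
    \int[lam2]_(z in Om2) ((u z.1 - u z.2) ^+ 2 * frac_ker s z.1 z.2)%:E)%E.
  by apply: eq_integral => z _; rewrite gag_sqr.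
rewrite /Hs/= -E; split => [?|[]//]; split => //.
by apply: measurable_funTS; apply: measurable_gag; exact: L2_measurable.
Qed.

Lemma gag_lin a u v z : gag (a *: u + v : L2 oOm) z = a * gag u z + gag v z.
Proof. by rewrite /gag !Lfun_linE; ring. Qed.

Lemma Hs_lin a u v : Hs s u -> Hs s v -> Hs s (a *: u + v).
Proof.
move=> /Hs_sqint su /Hs_sqint sv; apply/Hs_sqint.
by have := sqint_lin mOm2 a su sv; congr sqint; apply/funext => z; rewrite gag_lin.
Qed.

Definition Lint sigma u v (z : 'rV[R]_N * 'rV[R]_N) : R :=
  (u z.1 - u z.2) * (v z.1 - v z.2) * frac_ker s z.1 z.2
     * sigma (enorm (z.1 - z.2)).

Lemma LintE sigma u v z :
  Lint sigma u v z = gag u z * gag v z * sigma (enorm (z.1 - z.2)).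
Proof. by rewrite /Lint -gagM. Qed.

Lemma measurable_weight sigma :
  measurable_fun [set: 'rV[R]_N * 'rV[R]_N] (fun z => sigma (enorm (z.1 - z.2))).
Proof.
have ms : measurable_fun [set: measurableTypeR R] sigma by exact: measurable_funPT.
exact: (measurableT_comp ms (@measurable_enormB R N)).
Qed.

Lemma measurable_Lint sigma u v :
  measurable_fun [set: 'rV[R]_N * 'rV[R]_N] (Lint sigma u v).
Proof.
rewrite (_ : Lint _ _ _ = fun z => gag u z * gag v z * sigma (enorm (z.1 - z.2))).
  apply: measurable_funM; last exact: measurable_weight.
  by apply: measurable_funM; apply: measurable_gag; exact: L2_measurable.
by apply/funext => z; rewrite LintE.
Qed.

Notation W := (Wad (Om := Om) gamma1 gamma2 delta).

(** The diagonal is excluded because the distance 0 lies outside the interval. The difference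
    [u z.1 - u z.2] vanishes there, whence the case split on [z.1 = z.2] wherever these bounds are
    used. *)
Lemma Wad_ae sigma : W sigma ->
  {ae lam2, forall z, Om2 z -> z.1 <> z.2 ->
    0 <= sigma (enorm (z.1 - z.2)) <= gamma2 /\
    (enorm (z.1 - z.2) < delta -> gamma1 <= sigma (enorm (z.1 - z.2)))}.
Proof.
move=> [s1 s2].
have H : {ae mu_itv Om, forall t, 0 <= sigma t <= gamma2 /\
    (t < delta -> gamma1 <= sigma t)} by apply: filterS2 s1 s2.
exact: (ae_mu_itv_pairs N_gt0 bOm H).
Qed.

Lemma Lint_integrable sigma u v : W sigma -> Hs s u -> Hs s v ->
  lam2.-integrable Om2 (fun z => (Lint sigma u v z)%:E).
Proof.
move=> Ws /Hs_sqint su /Hs_sqint sv; apply/integrableP; split.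
  by apply/measurable_EFinP; apply: measurable_funTS; exact: measurable_Lint.
have iuv := sqint_mul mOm2 su sv.
have g0 : 0 <= gamma2 by apply: le_trans gamma12; exact: ltW.
apply: (@le_lt_trans _ _ (\int[lam2]_(z in Om2) (gamma2%:E * `|(gag u z * gag v z)%:E|))%E).
  apply: ae_ge0_le_integral => //.
  - apply: measurableT_comp => //; apply/measurable_EFinP.
    by apply: measurable_funTS; exact: measurable_Lint.
  - by move=> z _; rewrite mule_ge0.
  - apply: measurable_funeM; apply: measurableT_comp => //.
    exact: measurable_int iuv.
  apply: filterS (Wad_ae Ws) => z H Oz; rewrite LintE -EFinM lee_fin.
  have [e|/(H Oz)[/andP[s0 s2] _]] := pselect (z.1 = z.2).
    by rewrite /gag e subrr !mul0r normr0 mulr0.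
  by rewrite normrM mulrC ler_wpM2r// ger0_norm.
rewrite ge0_integralZl//; last first.
  by apply: measurableT_comp => //; exact: measurable_int iuv.
apply: lte_mul_pinfty => //.
by have /integrableP[] := iuv.
Qed.

Lemma Lop_sym sigma u v : Lop s sigma u v = Lop s sigma v u.
Proof. by apply: eq_Rintegral => z _; rewrite (mulrC (u _ - _)). Qed.

Lemma Lop_lin sigma a u v w : W sigma -> Hs s u -> Hs s v -> Hs s w ->
  Lop s sigma (a *: u + v) w = a * Lop s sigma u w + Lop s sigma v w.
Proof.
move=> Ws hu hv hw.
have iu := Lint_integrable Ws hu hw; have iv := Lint_integrable Ws hv hw.
rewrite /Lop -RintegralZl// -RintegralD//; last first.
  by rewrite /comp; under eq_fun do rewrite EFinM; exact: integrableZl.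
by apply: eq_Rintegral => z _; rewrite !Lfun_linE; ring.
Qed.

(** Integrability is assumed rather than feasibility, because the rule must also apply to the
    direction [omega - sigma], which may change sign. *)
Lemma Lop_weight a sigma tau u v :
  lam2.-integrable Om2 (fun z => (Lint sigma u v z)%:E) ->
  lam2.-integrable Om2 (fun z => (Lint tau u v z)%:E) ->
  Lop s (a *: sigma + tau) u v = a * Lop s sigma u v + Lop s tau u v.
Proof.
move=> iu iv.
rewrite /Lop -RintegralZl// -RintegralD//; last first.
  by rewrite /comp; under eq_fun do rewrite EFinM; exact: integrableZl.
by apply: eq_Rintegral => z _; rewrite !Lfun_linE; ring.
Qed.

(** A feasible weight is nonnegative only almost everywhere; the absolute value makes the integrand
    nonnegative everywhere, as the extended-real integral rules used below require. *)
Lemma Lop_sqrE sigma u : W sigma -> Hs s u ->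
  ((Lop s sigma u u)%:E =
   \int[lam2]_(z in Om2) (gag u z ^+ 2 * `|sigma (enorm (z.1 - z.2))|)%:E)%E.
Proof.
move=> Ws hu; have iu := Lint_integrable Ws hu hu.
rewrite fineK; last exact: integrable_fin_num.
apply: ae_eq_integral => //.
- exact: measurable_int iu.
- apply/measurable_EFinP; apply: measurable_funTS; apply: measurable_funM.
    by apply: measurable_funX; apply: measurable_gag; exact: L2_measurable.
  by apply: measurableT_comp => //; exact: measurable_weight.
apply: filterS (Wad_ae Ws) => z H Oz; congr EFin.
rewrite -/(Lint sigma u u z) LintE -expr2.
have [e|/(H Oz)[/andP[s0 s2] _]] := pselect (z.1 = z.2).
  by rewrite /gag e subrr !mul0r expr0n/= !mul0r.
by rewrite ger0_norm.
Qed.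

Lemma Lop_ge0 sigma u : W sigma -> Hs s u -> 0 <= Lop s sigma u u.
Proof.
move=> Ws hu; rewrite -lee_fin Lop_sqrE//; apply: integral_ge0 => z _.
by rewrite lee_fin mulr_ge0// sqr_ge0.
Qed.

End nonlocal_form.

(** * Coercivity *)

Section coercivity.
Context {R : realType} {N : nat} (Om : set 'rV[R]_N).
Hypotheses (N_gt0 : (0 < N)%N) (oOm : open Om) (bOm : bounded_set Om).
Hypotheses (Om_neq0 : Om !=set0) (cOm : connected Om).
Variables (s gamma1 gamma2 delta : R).
Hypothesis (s01 : 0 < s < 1).
Hypotheses (gamma1_gt0 : 0 < gamma1) (gamma12 : gamma1 <= gamma2).
Hypothesis (delta_gt0 : 0 < delta).
Notation lam := (@lebesgue_rV R N).
Notation lam2 := (lam \x lam)%E.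
Notation Om2 := (Om `*` Om).
Notation W := (Wad (Om := Om) gamma1 gamma2 delta).
Implicit Types (u v w : L2 oOm) (sigma : Linf Om).

Let mOm : measurable Om. Proof. exact: open_measurable_rV. Qed.
Let mOm2 : measurable Om2. Proof. exact: measurableX. Qed.

Let p : R := N%:R + 2 * s.
Let p_gt0 : 0 < p.
Proof. by have /andP[s0 _] := s01; rewrite ltr_wpDl// mulr_gt0. Qed.
Let dp := delta `^ p.
Let dp_gt0 : 0 < dp. Proof. exact: powR_gt0. Qed.

Let ker_near (x y : 'rV[R]_N) : x <> y -> enorm (x - y) < delta ->
  dp^-1 <= frac_ker s x y.
Proof.
move=> /eqP xy lt_d; have e0 : 0 < enorm (x - y) by rewrite enorm_gt0// subr_eq0.
rewrite /frac_ker lef_pV2 ?posrE ?powR_gt0//.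
by apply: ge0_ler_powR; rewrite ?nnegrE ?(ltW e0) ?(ltW lt_d) ?(ltW p_gt0) ?(ltW delta_gt0).
Qed.

Let ker_far (x y : 'rV[R]_N) : delta <= enorm (x - y) -> frac_ker s x y <= dp^-1.
Proof.
move=> de; have e0 : 0 < enorm (x - y) by exact: lt_le_trans de.
rewrite /frac_ker lef_pV2 ?posrE ?powR_gt0//.
by apply: ge0_ler_powR; rewrite ?nnegrE ?(ltW e0) ?de ?(ltW p_gt0) ?(ltW delta_gt0).
Qed.

Let wint sigma u z := (gag s u z ^+ 2 * `|sigma (enorm (z.1 - z.2))|)%:E.

Let mgag2 u : measurable_fun Om2 (fun z => (gag s u z ^+ 2)%:E).
Proof.
apply/measurable_EFinP; apply: measurable_funTS; apply: measurable_funX.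
by apply: measurable_gag; exact: L2_measurable.
Qed.

Let mwint sigma u : measurable_fun Om2 (wint sigma u).
Proof.
apply/measurable_EFinP; apply: measurable_funTS; apply: measurable_funM.
  by apply: measurable_funX; apply: measurable_gag; exact: L2_measurable.
by apply: measurableT_comp => //; exact: measurable_weight.
Qed.

Let wint_ge0 sigma u z : (0 <= wint sigma u z)%E.
Proof. by rewrite lee_fin mulr_ge0// sqr_ge0. Qed.

Lemma Lop_le sigma u : W sigma -> Hs s u ->
  ((Lop s sigma u u)%:E <= gamma2%:E * \int[lam2]_(z in Om2) (gag s u z ^+ 2)%:E)%E.
Proof.
move=> Ws hu; have g0 : 0 <= gamma2 by apply: le_trans gamma12; exact: ltW.
rewrite (Lop_sqrE N_gt0 bOm gamma1_gt0 gamma12 Ws hu) -ge0_integralZl//; last first.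
  by move=> z _; rewrite lee_fin sqr_ge0.
apply: ae_ge0_le_integral => //.
- by move=> z _; exact: wint_ge0.
- exact: mwint.
- by move=> z _; rewrite mule_ge0// lee_fin sqr_ge0.
- exact: measurable_funeM.
apply: filterS (Wad_ae N_gt0 bOm Ws) => z H Oz; rewrite -EFinM lee_fin.
have [e|/(H Oz)[/andP[s0 s2] _]] := pselect (z.1 = z.2).
  by rewrite /gag e subrr mul0r expr0n/= mul0r mulr0.
by rewrite mulrC ler_wpM2r ?sqr_ge0// ger0_norm.
Qed.

(** At almost all near pairs off the diagonal the kernel is at least [dp^-1] and the weight at least
    [gamma1]. *)
Let near_le sigma u : W sigma -> Hs s u ->
  (near_energy Om delta u <= (dp / gamma1)%:E * (Lop s sigma u u)%:E)%E.
Proof.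
move=> Ws hu; have K0 : 0 <= dp / gamma1 by rewrite divr_ge0// ltW.
rewrite (Lop_sqrE N_gt0 bOm gamma1_gt0 gamma12 Ws hu).
rewrite -ge0_integralZl//; first last.
- by move=> z _; exact: wint_ge0.
- exact: mwint.
have nO : near_pairs Om delta `<=` Om2 by move=> z [].
have mn := measurable_near_pairs delta oOm.
apply: (@le_trans _ _ (\int[lam2]_(z in near_pairs Om delta)
    ((dp / gamma1)%:E * wint sigma u z))%E); last first.
  apply: ge0_subset_integral => //; first exact: measurable_funeM.
  by move=> z _; rewrite mule_ge0.
apply: ae_ge0_le_integral => //.
- by move=> z _; rewrite lee_fin sqr_ge0.
- apply/measurable_EFinP; apply: measurable_funTS; apply: measurable_funX.
  by apply: measurable_funB; apply: measurableT_comp => //; exact: L2_measurable.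
- by move=> z _; rewrite mule_ge0.
- apply: measurable_funeM; exact: measurable_funS (mwint sigma u).
apply: filterS (Wad_ae N_gt0 bOm Ws) => z H [Oz zd]; rewrite -EFinM lee_fin.
have [e|ne] := pselect (z.1 = z.2).
  by rewrite /gag e subrr mul0r expr0n/= mul0r mulr0.
have [/andP[s0 s2] /(_ zd) s1] := H Oz ne.
rewrite gag_sqr ger0_norm//.
apply: (@le_trans _ _ (dp / gamma1 * ((u z.1 - u z.2) ^+ 2 * dp^-1 * gamma1))).
  rewrite le_eqVlt; apply/orP; left; apply/eqP; field; rewrite !gt_eqF//.
apply: ler_wpM2l => //; apply: ler_pM => //.
- by rewrite mulr_ge0 ?sqr_ge0// invr_ge0 ltW.
- exact: ltW.
- by apply: ler_wpM2l; [exact: sqr_ge0|exact: ker_near].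
Qed.

(** Near pairs use [sigma >= gamma1]. Far pairs use that the kernel is at most [dp^-1] and that [(u
    x - u y) ^ 2 <= 2 (u x - c) ^ 2 + 2 (u y - c) ^ 2]; the two terms have equal integrals, which
    doubles 2 to 4. *)
Let far_le sigma u (c : R) : W sigma -> Hs s u ->
  (\int[lam2]_(z in Om2) (gag s u z ^+ 2)%:E <=
   (gamma1^-1)%:E * (Lop s sigma u u)%:E +
   (4 * dp^-1)%:E * (lam Om * \int[lam]_(x in Om) ((u x - c) ^+ 2)%:E))%E.
Proof.
move=> Ws hu; have i10 : 0 <= gamma1^-1 by rewrite invr_ge0 ltW.
have d0 : 0 <= 2 * dp^-1 by rewrite mulr_ge0// invr_ge0 ltW.
pose h x := ((u x - c) ^+ 2)%:E.
have mh : measurable_fun [set: 'rV[R]_N] h.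
  apply/measurable_EFinP; apply: measurable_funX.
  by apply: measurable_funB => //; exact: L2_measurable.
have h0 x : (0 <= h x)%E by rewrite lee_fin sqr_ge0.
have mh1 : measurable_fun Om2 (fun z => h z.1).
  by apply: measurable_funTS; exact: (measurableT_comp mh).
have mh2 : measurable_fun Om2 (fun z => h z.2).
  by apply: measurable_funTS; exact: (measurableT_comp mh).
have -> : ((4 * dp^-1)%:E * (lam Om * \int[lam]_(x in Om) h x) =
    (2 * dp^-1)%:E * (\int[lam2]_(z in Om2) h z.1 + \int[lam2]_(z in Om2) h z.2))%E.
  rewrite (ge0_integral_rectangle1 lam lam mOm mOm mh)//.
  rewrite (ge0_integral_rectangle2 lam lam mOm mOm mh)//.
  have -> : 4 * dp^-1 = 2 * dp^-1 * 2 by ring.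
  by rewrite EFinM -muleA; congr (_ * _)%E; rewrite -mule2n mule_natl.
rewrite -ge0_integralD// -ge0_integralZl//; first last.
- by move=> z _; rewrite adde_ge0.
- exact: emeasurable_funD.
rewrite (Lop_sqrE N_gt0 bOm gamma1_gt0 gamma12 Ws hu).
rewrite -ge0_integralZl//; first last.
- by move=> z _; exact: wint_ge0.
- exact: mwint.
rewrite -ge0_integralD//; first last.
- by apply: measurable_funeM; exact: emeasurable_funD.
- by move=> z _; rewrite mule_ge0// adde_ge0.
- by apply: measurable_funeM; exact: mwint.
- by move=> z _; rewrite mule_ge0// wint_ge0.
apply: ae_ge0_le_integral => //.
- by move=> z _; rewrite lee_fin sqr_ge0.
- by move=> z _; rewrite adde_ge0 ?mule_ge0 ?adde_ge0// wint_ge0.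
- apply: emeasurable_funD; apply: measurable_funeM; first exact: mwint.
  exact: emeasurable_funD.
apply: filterS (Wad_ae N_gt0 bOm Ws) => z H Oz; rewrite /h -EFinD lee_fin.
have sq : 0 <= 2 * dp^-1 * ((u z.1 - c) ^+ 2 + (u z.2 - c) ^+ 2).
  by rewrite mulr_ge0// addr_ge0// sqr_ge0.
have [e|ne] := pselect (z.1 = z.2).
  by rewrite {1 2}/gag e subrr mul0r expr0n/= mul0r mulr0 add0r -{1}e.
have [/andP[s0 s2] s1] := H Oz ne.
have [zd|dz] := ltP (enorm (z.1 - z.2)) delta.
  rewrite ler_wpDr// ger0_norm// mulrCA ler_peMr ?sqr_ge0//.
  by rewrite mulrC ler_pdivlMr// mul1r s1.
apply: ler_wpDl; first by rewrite mulr_ge0// mulr_ge0// sqr_ge0.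
rewrite gag_sqr.
apply: (@le_trans _ _ ((u z.1 - u z.2) ^+ 2 * dp^-1)).
  by apply: ler_wpM2l; [exact: sqr_ge0|exact: ker_far].
rewrite mulrC (mulrC 2) -mulrA ler_wpM2l ?invr_ge0 ?(ltW dp_gt0)//.
by have := sqr_ge0 ((u z.1 - c) + (u z.2 - c)); lra.
Qed.

(** [poincare_near] with [near_le] bounds the distance to a constant by [C1] times the form;
    inserted in [far_le] this bounds the Gagliardo energy by [C2] times the form. *)
Theorem Wad_coercive : exists2 C : R, 0 <= C & forall sigma u, W sigma -> Hs s u ->
  (exists c, (\int[lam]_(x in Om) ((u x - c) ^+ 2)%:E <= (C * Lop s sigma u u)%:E)%E)
  /\ (\int[lam2]_(z in Om2) (gag s u z ^+ 2)%:E <= (C * Lop s sigma u u)%:E)%E.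
Proof.
have [C0 C00 HP] := poincare_near Om_neq0 oOm cOm bOm delta_gt0.
have lfin : lam Om \is a fin_num.
  by rewrite ge0_fin_numE//; exact: lebesgue_rV_bounded_lty.
pose l := fine (lam Om); have l0 : 0 <= l by exact: fine_ge0.
pose C1 := C0 * (dp / gamma1); pose C2 := gamma1^-1 + 4 * dp^-1 * (l * C1).
have C10 : 0 <= C1 by rewrite mulr_ge0// divr_ge0// ltW.
have i10 : 0 <= gamma1^-1 by rewrite invr_ge0 ltW.
have d0 : 0 <= dp^-1 by rewrite invr_ge0 ltW.
have C20 : 0 <= C2 by apply: addr_ge0 => //; apply: mulr_ge0; apply: mulr_ge0.
exists (C1 + C2); first exact: addr_ge0.
move=> sigma u Ws hu; have L0 := Lop_ge0 N_gt0 bOm gamma1_gt0 gamma12 Ws hu.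
have [c cP] := HP u (L2_measurable u) (L2_sqint u).2.
have {}cP : (\int[lam]_(x in Om) ((u x - c) ^+ 2)%:E <= (C1 * Lop s sigma u u)%:E)%E.
  apply: (le_trans cP); rewrite /C1 -mulrA EFinM lee_wpmul2l ?lee_fin//.
  by rewrite EFinM; exact: near_le.
split.
  exists c; apply: (le_trans cP); rewrite lee_fin ler_wpM2r// lerDl//.
apply: (le_trans (far_le c Ws hu)).
apply: (@le_trans _ _ (C2 * Lop s sigma u u)%:E); last first.
  by rewrite lee_fin ler_wpM2r// lerDr.
have -> : (C2 * Lop s sigma u u)%:E = ((gamma1^-1 * Lop s sigma u u)%:E +
    (4 * dp^-1 * (l * (C1 * Lop s sigma u u)))%:E)%E.
  by rewrite -EFinD /C2; congr EFin; ring.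
apply: leeD; first by rewrite EFinM.
rewrite [leRHS]EFinM; apply: lee_wpmul2l; first by rewrite lee_fin mulr_ge0.
by rewrite EFinM -(fineK lfin) -/l; apply: lee_wpmul2l; rewrite ?lee_fin.
Qed.

End coercivity.

(** * The form of the state equation *)

Section state_form.
Context {R : realType} {N : nat} (Om : set 'rV[R]_N).
Hypotheses (N_gt0 : (0 < N)%N) (oOm : open Om) (bOm : bounded_set Om).
Hypotheses (Om_neq0 : Om !=set0) (cOm : connected Om).
Variables (s gamma1 gamma2 delta : R).
Hypothesis (s01 : 0 < s < 1).
Hypotheses (gamma1_gt0 : 0 < gamma1) (gamma12 : gamma1 <= gamma2).
Hypothesis (delta_gt0 : 0 < delta).
Variable S : L2 oOm -> L2 oOm.
Hypothesis blS : bounded_linear_op S.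
Notation lam := (@lebesgue_rV R N).
Notation lam2 := (lam \x lam)%E.
Notation Om2 := (Om `*` Om).
Notation W := (Wad (Om := Om) gamma1 gamma2 delta).
Notation V := (L2 oOm).
Implicit Types (u v w : V) (sigma : Linf Om).

Let mOm : measurable Om. Proof. exact: open_measurable_rV. Qed.

Lemma L2_sum (d : nat -> V) n x : (\sum_(k < n) d k : V) x = \sum_(k < n) d k x.
Proof. by elim: n => [|n IH]; rewrite ?big_ord0// !big_ord_recr/= -IH. Qed.

Lemma L2dot_sqrD a u v : L2dot (a *: u + v) (a *: u + v) =
  a ^+ 2 * L2dot u u + 2 * a * L2dot u v + L2dot v v.
Proof.
apply: (@form_sqrD R V setT (@L2dot R N Om oOm)) => //.
- by move=> *; exact: L2dotC.
- by move=> *; exact: L2dot_lin.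
Qed.

Lemma L2dot_cauchy_schwarz u v : L2dot u v ^+ 2 <= L2dot u u * L2dot v v.
Proof.
apply: (@form_cauchy_schwarz R V setT (@L2dot R N Om oOm)) => //.
- by move=> *; exact: L2dotC.
- by move=> *; exact: L2dot_lin.
- by move=> *; exact: L2dot_ge0.
Qed.

Lemma ex_const1 : exists cst1 : V, cst1 = (fun=> 1) :> ('rV[R]_N -> R).
Proof.
have [|u uE] := @L2_ofP R N Om oOm (cst 1) (measurable_cst _).
  rewrite (_ : \int[lam]_(x in Om) _ = 1 * lam Om)%E; last first.
    rewrite -(integral_cst lam mOm); apply: eq_integral => x _.
    by rewrite /= expr1n.
  by rewrite mul1e; exact: lebesgue_rV_bounded_lty.
by exists u; rewrite -uE.
Qed.

Definition cst1 : V := projT1 (cid ex_const1).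

Lemma cst1E x : cst1 x = 1.
Proof. by rewrite /cst1; case: cid => u /= ->. Qed.

Lemma gag_shift c u z : gag s (c *: cst1 + u : V) z = gag s u z.
Proof. by rewrite /gag !Lfun_linE !cst1E; congr (_ * _); ring. Qed.

Lemma Hs_cst1 : Hs s cst1.
Proof.
apply/Hs_sqint; have -> : gag s cst1 = cst 0.
  by apply/funext => z; rewrite /gag !cst1E subrr mul0r.
split; first exact: measurable_cst.
by under eq_integral do rewrite expr0n/=; rewrite integral0.
Qed.

Lemma Lop_cst1 sigma v : Lop s sigma cst1 v = 0.
Proof.
rewrite /Lop /Rintegral integral0_eq// => z _.
by rewrite !cst1E subrr !mul0r.
Qed.

Lemma L2dot_S_lin a u v w :
  L2dot (S (a *: u + v)) w = a * L2dot (S u) w + L2dot (S v) w.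
Proof. by rewrite (L2dot_ae w (blS.1 a u v)) L2dot_lin. Qed.

Lemma L2dot_S_bounded : exists2 C : R, 0 <= C &
  forall u, L2dot (S u) (S u) <= C * L2dot u u.
Proof.
have [_ [C SC]] := blS; exists (C ^+ 2); first exact: sqr_ge0.
move=> u; rewrite -!L2norm_sqr -exprMn.
have n0 : 0 <= L2norm (S u) by rewrite fine_ge0// Lnorm_ge0.
by rewrite ler_pXn2r// nnegrE (le_trans n0).
Qed.

Definition state_form sigma u v := L2dot (S u) (S v) + Lop s sigma u v.
Notation B := state_form.

Lemma state_form_sym sigma u v : B sigma u v = B sigma v u.
Proof. by rewrite /state_form L2dotC Lop_sym. Qed.

Lemma state_form_lin sigma a u v w : W sigma -> Hs s u -> Hs s v -> Hs s w ->
  B sigma (a *: u + v) w = a * B sigma u w + B sigma v w.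
Proof.
move=> Ws hu hv hw; rewrite /state_form L2dot_S_lin.
by rewrite (Lop_lin N_gt0 bOm gamma1_gt0 gamma12 a Ws hu hv hw); ring.
Qed.

Let Lop_pos sigma u : W sigma -> Hs s u -> 0 <= Lop s sigma u u.
Proof. exact: Lop_ge0. Qed.

Lemma state_form_ge0 sigma u : W sigma -> Hs s u -> 0 <= B sigma u u.
Proof. by move=> Ws hu; rewrite addr_ge0 ?L2dot_ge0 ?Lop_pos. Qed.

(** The product condition encodes the alternative that [c = 0] or [S] sends constants to a function
    of norm 0; in the latter case Cauchy-Schwarz removes the inner product with [S v]. *)
Lemma state_form_shift sigma c u v : W sigma -> Hs s u -> Hs s v ->
  c * L2dot (S cst1) (S cst1) = 0 -> B sigma (c *: cst1 + u) v = B sigma u v.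
Proof.
move=> Ws hu hv c0; rewrite (state_form_lin _ Ws Hs_cst1 hu hv).
rewrite {1}/state_form Lop_cst1 addr0.
have -> : c * L2dot (S cst1) (S v) = 0; last by rewrite add0r.
have [->|cn0] := eqVneq c 0; first by rewrite mul0r.
move/eqP: c0; rewrite mulf_eq0 (negbTE cn0)/= => /eqP m0.
have := L2dot_cauchy_schwarz (S cst1) (S v); rewrite m0 mul0r => le0.
have /eqP : L2dot (S cst1) (S v) ^+ 2 = 0 by apply/eqP; rewrite eq_le le0 sqr_ge0.
by rewrite sqrf_eq0 => /eqP ->; rewrite mulr0.
Qed.

(* Constants are the only possible degenerate directions of the form; [c] removes
   the mean value of [u] precisely when [S] annihilates constants. *)
Lemma state_form_coercive : exists2 K : R, 0 <= K &
  forall sigma u, W sigma -> Hs s u ->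
  (exists c, c * L2dot (S cst1) (S cst1) = 0 /\
     L2dot (c *: cst1 + u) (c *: cst1 + u) <= K * B sigma u u) /\
  (\int[lam2]_(z in Om2) (gag s u z ^+ 2)%:E <= (K * B sigma u u)%:E)%E.
Proof.
have [C C0 HC] := Wad_coercive N_gt0 oOm bOm Om_neq0 cOm s01 gamma1_gt0 gamma12 delta_gt0.
have [CS CS0 HS] := L2dot_S_bounded.
pose m := L2dot (S cst1) (S cst1); pose l := L2dot cst1 cst1.
have mE : m = L2dot (S cst1) (S cst1) by [].
have lE : l = L2dot cst1 cst1 by [].
have m0 : 0 <= m by exact: L2dot_ge0.
have l0 : 0 <= l by exact: L2dot_ge0.
(* For [m > 0] and [w = u - c], one has [|u|^2 <= 2 c^2 l + 2 |w|^2], where [|w|^2] is at most [C]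
   times the form and [c^2 m] at most [2 + 2 CS C] times it. For [m = 0] only [K1 >= 0] matters. *)
pose K1 := 2 * C + 2 * (l / m) * (2 + 2 * CS * C).
have K10 : 0 <= K1.
  by apply: addr_ge0; apply: mulr_ge0 => //; [apply: mulr_ge0 => //; exact: divr_ge0|
    apply: addr_ge0 => //; rewrite !mulr_ge0].
exists (C + K1); first exact: addr_ge0.
move=> sigma u Ws hu; have [[c cP] gP] := HC sigma u Ws hu.
have L0 := Lop_pos Ws hu; have B0 := state_form_ge0 Ws hu.
have LB : Lop s sigma u u <= B sigma u u by rewrite lerDr L2dot_ge0.
have {}cP : L2dot (- c *: cst1 + u) (- c *: cst1 + u) <= C * Lop s sigma u u.
  rewrite -lee_fin L2dotE; apply: le_trans cP; rewrite le_eqVlt; apply/orP; left.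
  apply/eqP; apply: eq_integral => x _; rewrite Lfun_linE cst1E; congr (_ ^+ 2)%:E; ring.
split; last first.
  apply: (le_trans gP); rewrite lee_fin; apply: ler_pM => //.
  by rewrite lerDl.
have [em|nm] := eqVneq m 0.
  exists (- c); rewrite -/m em mulr0; split => //; apply: (le_trans cP).
  by apply: ler_pM => //; rewrite lerDl.
exists 0; rewrite mul0r scale0r add0r; split => //.
set w := - c *: cst1 + u in cP.
have uE : u = c *: cst1 + w by rewrite /w addrA -scalerDl subrr scale0r add0r.
clearbody w m l.
have X1 : L2dot u u <= 2 * (c ^+ 2 * l) + 2 * L2dot w w.
  have := L2dot_ge0 (- c *: cst1 + w); rewrite uE !L2dot_sqrD.
  move: (L2dot cst1 cst1) (L2dot cst1 w) (L2dot w w) (lE) => a b e ->; lra.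
have X2 : c ^+ 2 * m <= 2 * L2dot (S u) (S u) + 2 * (CS * L2dot w w).
  (* Four times this square is [2 |S u|^2 + 2 |S w|^2 - c^2 m], as [S u] is [c S cst1 + S w] inside
     inner products. *)
  have := L2dot_ge0 (2^-1 * c *: S cst1 + S w); rewrite L2dot_sqrD.
  have E : L2dot (S u) (S u) =
      c ^+ 2 * m + 2 * c * L2dot (S cst1) (S w) + L2dot (S w) (S w).
    rewrite {1}uE L2dot_S_lin (L2dotC _ (S u)) (L2dotC _ (S u)) uE !L2dot_S_lin.
    rewrite mE (L2dotC (S w) (S cst1)).
    by move: (L2dot (S cst1) (S cst1)) (L2dot (S cst1) (S w)) (L2dot (S w) (S w)) => x y z; ring.
  rewrite E -mE; have := HS w.
  move: (L2dot (S cst1) (S w)) (L2dot (S w) (S w)) (CS * _) => y z t; lra.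
have mp : 0 < m by rewrite lt_neqAle eq_sym nm m0.
have X3 : c ^+ 2 * l <= l / m * (2 + 2 * CS * C) * B sigma u u.
  have -> : c ^+ 2 * l = l / m * (c ^+ 2 * m) by field.
  rewrite -[leRHS]mulrA; apply: ler_wpM2l; first exact: divr_ge0.
  apply: (le_trans X2); have := ler_wpM2l CS0 cP; rewrite /state_form.
  have := L2dot_ge0 (S u); have := mulr_ge0 CS0 (mulr_ge0 C0 (L2dot_ge0 (S u))).
  move: L0; move: (L2dot (S u) (S u)) (Lop s sigma u u) (L2dot w w) => x y z; lra.
have CB := ler_wpM2l C0 LB.
have CB0 := mulr_ge0 C0 B0.
rewrite /K1; move: X1 X3 CB CB0 cP.
move: (L2dot u u) (L2dot w w) (Lop s sigma u u) (B sigma u u) => x y z t.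
move: (l / m) (c ^+ 2 * l) => a b; lra.
Qed.

End state_form.

(** * Solving the state equation *)

Section solve.
Context {R : realType} {N : nat} (Om : set 'rV[R]_N).
Hypotheses (N_gt0 : (0 < N)%N) (oOm : open Om) (bOm : bounded_set Om).
Hypotheses (Om_neq0 : Om !=set0) (cOm : connected Om).
Variables (s gamma1 gamma2 delta : R).
Hypothesis (s01 : 0 < s < 1).
Hypotheses (gamma1_gt0 : 0 < gamma1) (gamma12 : gamma1 <= gamma2).
Hypothesis (delta_gt0 : 0 < delta).
Variable S : L2 oOm -> L2 oOm.
Hypothesis blS : bounded_linear_op S.
Notation lam := (@lebesgue_rV R N).
Notation lam2 := (lam \x lam)%E.
Notation Om2 := (Om `*` Om).
Notation W := (Wad (Om := Om) gamma1 gamma2 delta).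
Notation V := (L2 oOm).
Implicit Types (u v w : V) (sigma : Linf Om).

Notation B := (state_form s S).
Notation one := (cst1 oOm bOm).

Let mOm : measurable Om. Proof. exact: open_measurable_rV. Qed.
Let mOm2 : measurable Om2. Proof. exact: measurableX. Qed.

Let Hs_linP a u v : Hs s u -> Hs s v -> Hs s (a *: u + v).
Proof. exact: Hs_lin. Qed.

Let series_shift (f : nat -> R) n l : series f m @[m --> \oo] --> l ->
  series (fun k => f (n + k)%N) m @[m --> \oo] --> l - series f n.
Proof.
move=> fl.
have -> : series (fun k => f (n + k)%N) = (fun m => series f (m + n)%N - series f n).
  apply/funext => m; rewrite /series/= (@big_cat_nat _ _ _ n _ (m + n))//=; last exact: leq_addl.
  rewrite addrAC subrr add0r -{2}(add0n n) big_addn addnK.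
  by apply: eq_bigr => i _; rewrite addnC.
apply: cvgB; last exact: cvg_cst.
by rewrite (cvg_shiftn n (series f)).
Qed.

(** The remainder after [n] terms is itself the sum of a rapid series, with constants scaled by
    [4 ^- n]; so [rapid_series_sqr_le] gives the rate as well as the limit. *)
Lemma L2_rapid_limit (e : nat -> V) (C1 C2 : R) : 0 <= C1 -> 0 <= C2 ->
  (forall k, Hs s (e k)) -> (forall k, L2dot (e k) (e k) <= C1 * 4 ^- k) ->
  (forall k, \int[lam2]_(z in Om2) (gag s (e k) z ^+ 2)%:E <= (C2 * 4 ^- k)%:E)%E ->
  exists g : V, forall n, [/\ Hs s (g - \sum_(k < n) e k),
    L2dot (g - \sum_(k < n) e k) (g - \sum_(k < n) e k) <= 4 * (C1 * 4 ^- n) &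
    (\int[lam2]_(z in Om2) (gag s (g - \sum_(k < n) e k : V) z ^+ 2)%:E <=
     (4 * (C2 * 4 ^- n))%:E)%E].
Proof.
move=> C10 C20 he e1 e2.
have me k : measurable_fun [set: 'rV[R]_N] (e k) by exact: L2_measurable.
have meO k : measurable_fun Om (e k) by exact: measurable_funTS.
have e1' k : (\int[lam]_(x in Om) (e k x ^+ 2)%:E <= (C1 * 4 ^- k)%:E)%E.
  by rewrite -L2dotE lee_fin.
have pow n k : (4 ^- (n + k) = 4 ^- n * 4 ^- k :> R) by rewrite exprD invfM.
have [g mg cg] := ae_series_limit me (rapid_series_ae_cvg mOm C10 meO e1').
have cgn n : {ae lam, forall x, Om x ->
    series (fun k => e (n + k)%N x) m @[m --> \oo] --> g x - \sum_(k < n) e k x}.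
  apply: filterS cg => x cx Ox; have := @series_shift _ n _ (cx Ox).
  by rewrite (_ : series (fun k => e k x) n = \sum_(k < n) e k x)//; exact: big_mkord.
have p4 n : 0 <= 4 ^- n :> R by rewrite invr_ge0 exprn_ge0.
have bnd n (h : 'rV[R]_N -> R) : measurable_fun [set: 'rV[R]_N] h ->
    (forall x, h x = g x - \sum_(k < n) e k x) ->
    (\int[lam]_(x in Om) (h x ^+ 2)%:E <= (4 * (C1 * 4 ^- n))%:E)%E.
  move=> mh hE; apply: (rapid_series_sqr_le mOm (f := fun k => e (n + k)%N)) => //.
  - by rewrite mulr_ge0.
  - by move=> k; rewrite -mulrA -pow.
  - exact: measurable_funTS.
  - by apply: filterS (cgn n) => x + Ox => /(_ Ox); rewrite hE.
have [||gL gE] := @L2_ofP R N Om oOm g.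
- exact: mg.
- apply: le_lt_trans (bnd 0%N g mg _) (ltry _) => x.
  by rewrite big_ord0 subr0.
exists gL => n.
set h := gL - _.
have hE x : h x = g x - \sum_(k < n) e k x.
  by rewrite /h gE -(L2_sum e n x).
have h1 := bnd n h (L2_measurable h) hE.
have h2 : (\int[lam2]_(z in Om2) (gag s h z ^+ 2)%:E <= (4 * (C2 * 4 ^- n))%:E)%E.
  apply: (rapid_series_sqr_le mOm2 (f := fun k => gag s (e (n + k)%N))) => //.
  - by rewrite mulr_ge0.
  - by move=> k; apply: measurable_funTS; apply: measurable_gag; exact: L2_measurable.
  - by move=> k; rewrite -mulrA -pow.
  - by apply: measurable_funTS; apply: measurable_gag; exact: L2_measurable.
  (* Convergence at almost every point gives convergence of the difference quotients at almost every
     pair, so the same limit [g] serves both norms. *)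
  - apply: filterS (ae_rectangle (cgn n) (cgn n)) => -[x y] H /H /= [cx cy].
    have -> : gag s h (x, y) = (g x - \sum_(k < n) e k x - (g y - \sum_(k < n) e k y))
        * Num.sqrt (frac_ker s x y) by rewrite -!hE.
    have -> : series (fun k => (e (n + k)%N x - e (n + k)%N y) * Num.sqrt (frac_ker s x y)) =
        fun m => (series (fun k => e (n + k)%N x) m - series (fun k => e (n + k)%N y) m)
          * Num.sqrt (frac_ker s x y).
      by apply/funext => m; rewrite /series/= -sumrB mulr_suml.
    by apply: cvgM; [exact: cvgB|exact: cvg_cst].
split => //; last by rewrite -lee_fin L2dotE.
apply/Hs_sqint; split; last exact: le_lt_trans h2 (ltry _).
by apply: measurable_funTS; apply: measurable_gag; exact: L2_measurable.
Qed.

Let Hs1 : Hs s one. Proof. exact: Hs_cst1. Qed.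

Let Hs0 : Hs s (0 : V).
Proof. by have := Hs_linP (-1) Hs1 Hs1; rewrite scaleN1r addNr. Qed.

Let Bsym sigma u v : B sigma u v = B sigma v u.
Proof. exact: state_form_sym. Qed.

Let Blin sigma a u v w : W sigma -> Hs s u -> Hs s v -> Hs s w ->
  B sigma (a *: u + v) w = a * B sigma u w + B sigma v w.
Proof. by move=> Ws hu hv hw; exact: (state_form_lin N_gt0 bOm gamma1_gt0 gamma12 blS a Ws). Qed.

Let Bge0 sigma u : W sigma -> Hs s u -> 0 <= B sigma u u.
Proof. exact: state_form_ge0. Qed.

Let Bshift sigma c u v : W sigma -> Hs s u -> Hs s v ->
  c * L2dot (S one) (S one) = 0 -> B sigma (c *: one + u) v = B sigma u v.
Proof.
by move=> Ws hu hv; exact: (state_form_shift N_gt0 gamma1_gt0 gamma12 blS Ws hu hv).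
Qed.

(** Each [d k] is shifted by a constant to become small in L2, and the shifted series is summed. Its
    partial sums differ from those of [d] by a constant to which the form is blind, so the limit
    also works for [d]. *)
Lemma state_form_complete sigma (C : R) (d : nat -> V) : W sigma ->
  (forall k, Hs s (d k)) -> (forall k, B sigma (d k) (d k) <= C * 4 ^- k) ->
  exists2 v, Hs s v & exists C', forall n,
    B sigma (v - \sum_(k < n) d k) (v - \sum_(k < n) d k) <= C' * 4 ^- n.
Proof.
move=> Ws hd dC.
have [K K0 HK] := state_form_coercive N_gt0 bOm Om_neq0 cOm s01 gamma1_gt0
  gamma12 delta_gt0 blS.
have [CS CS0 HS] := L2dot_S_bounded blS.
have C0 : 0 <= C.
  by have := dC 0%N; rewrite expr0 invr1 mulr1; apply: le_trans; exact: Bge0.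
have g0 : 0 <= gamma2 by apply: le_trans gamma12; exact: ltW.
have /choice[c cP] : forall k, exists c, c * L2dot (S one) (S one) = 0 /\
    L2dot (c *: one + d k) (c *: one + d k) <= K * B sigma (d k) (d k).
  by move=> k; have [] := HK sigma (d k) Ws (hd k).
pose e k : V := c k *: one + d k.
have he k : Hs s (e k) by exact: Hs_linP.
have e1 k : L2dot (e k) (e k) <= K * C * 4 ^- k.
  by apply: (le_trans (cP k).2); rewrite -mulrA; apply: ler_wpM2l.
have e2 k : (\int[lam2]_(z in Om2) (gag s (e k) z ^+ 2)%:E <= (K * C * 4 ^- k)%:E)%E.
  have [_ gP] := HK sigma (d k) Ws (hd k).
  under eq_integral do rewrite gag_shift.
  by apply: (le_trans gP); rewrite lee_fin -mulrA; apply: ler_wpM2l.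
have KC0 : 0 <= K * C by exact: mulr_ge0.
have [g gP] := L2_rapid_limit KC0 KC0 he e1 e2.
exists g; first by have [+ _ _] := gP 0%N; rewrite big_ord0 subr0.
exists (4 * (CS * (K * C)) + 4 * (gamma2 * (K * C))) => n.
have [hh h1 h2] := gP n; set h := g - _ in hh h1 h2.
have -> : g - \sum_(k < n) d k = (\sum_(k < n) c k) *: one + h.
  rewrite /h /e big_split/= -scaler_suml opprD.
  by rewrite [RHS]addrCA [X in _ = _ + X]addrA subrr add0r.
have cs0 : (\sum_(k < n) c k) * L2dot (S one) (S one) = 0.
  by rewrite mulr_suml big1// => k _; exact: (cP k).1.
have hh' : Hs s ((\sum_(k < n) c k) *: one + h) by exact: Hs_linP.
rewrite Bshift// Bsym Bshift//.
have H1 := le_trans (HS h) (ler_wpM2l CS0 h1).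
have H2 : Lop s sigma h h <= gamma2 * (4 * (K * C * 4 ^- n)).
  rewrite -lee_fin; apply: (le_trans (Lop_le N_gt0 bOm gamma1_gt0 gamma12 Ws hh)).
  by rewrite EFinM lee_wpmul2l.
rewrite /state_form; apply: (le_trans (lerD H1 H2)).
by rewrite le_eqVlt; apply/orP; left; apply/eqP; ring.
Qed.

(** [K] precedes [sigma] and [F] so that it can serve all [sigma_t] at once. A Riesz representative
    carries no L2 bound of its own; the shift given by coercivity supplies one without changing the
    form. *)
Lemma state_form_solve : exists2 K : R, 0 <= K & forall sigma (F : V -> R) (C : R),
  W sigma -> 0 <= C ->
  (forall a u v, Hs s u -> Hs s v -> F (a *: u + v) = a * F u + F v) ->
  (forall u, Hs s u -> F u ^+ 2 <= C * B sigma u u) ->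
  exists z, [/\ Hs s z, B sigma z z <= C, L2dot z z <= K * C &
    forall v, Hs s v -> B sigma z v = F v].
Proof.
have [K K0 HK] := state_form_coercive N_gt0 bOm Om_neq0 cOm s01 gamma1_gt0
  gamma12 delta_gt0 blS.
exists K => // sigma F C Ws C0 Flin Fbnd.
have [q hq qF] : exists2 q, Hs s q & forall v, Hs s v -> B sigma q v = F v.
  have sym u v : Hs s u -> Hs s v -> B sigma u v = B sigma v u by [].
  have lin a u v w : Hs s u -> Hs s v -> Hs s w ->
    B sigma (a *: u + v) w = a * B sigma u w + B sigma v w by exact: Blin.
  have pos u : Hs s u -> 0 <= B sigma u u by exact: Bge0.
  exact: (riesz_representation Hs0 Hs_linP sym lin pos
    (fun C' d => @state_form_complete sigma C' d Ws) Flin Fbnd C0).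
have [[c [c0 cK]] _] := HK sigma q Ws hq.
have BC : B sigma q q <= C.
  (* With [b] the form at [q], the bound on [F q = b] reads [b ^ 2 <= C b]. *)
  have := Fbnd q hq; rewrite -qF//; have := Bge0 Ws hq.
  move: (B sigma q q) => b b0; have [->//|bn] := eqVneq b 0.
  by rewrite expr2 ler_pM2r// lt_neqAle eq_sym bn.
have hz : Hs s (c *: one + q) by exact: Hs_linP.
exists (c *: one + q); split => //.
- by rewrite Bshift// Bsym Bshift.
- by apply: (le_trans cK); exact: ler_wpM2l.
- by move=> v hv; rewrite Bshift// qF.
Qed.

End solve.

(** * Optimality *)

Section optimality.
Context {R : realType} {N : nat} (Om : set 'rV[R]_N).
Hypotheses (N_gt0 : (0 < N)%N) (oOm : open Om) (bOm : bounded_set Om).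
Hypotheses (Om_neq0 : Om !=set0) (cOm : connected Om).
Variables (s gamma1 gamma2 delta : R).
Hypothesis (s01 : 0 < s < 1).
Hypotheses (gamma1_gt0 : 0 < gamma1) (gamma12 : gamma1 <= gamma2).
Hypothesis (delta_gt0 : 0 < delta).
Variable S : L2 oOm -> L2 oOm.
Hypothesis blS : bounded_linear_op S.
Notation lam := (@lebesgue_rV R N).
Notation lam2 := (lam \x lam)%E.
Notation Om2 := (Om `*` Om).
Notation W := (Wad (Om := Om) gamma1 gamma2 delta).
Notation V := (L2 oOm).
Implicit Types (u v w : V) (sigma : Linf Om).

Variable ydelta : L2 oOm.
Notation B := (state_form s S).

Let mOm : measurable Om. Proof. exact: open_measurable_rV. Qed.
Let mOm2 : measurable Om2. Proof. exact: measurableX. Qed.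

Let Hs_linP a u v : Hs s u -> Hs s v -> Hs s (a *: u + v).
Proof. exact: Hs_lin. Qed.

Let Llin sigma a u v w : W sigma -> Hs s u -> Hs s v -> Hs s w ->
  Lop s sigma (a *: u + v) w = a * Lop s sigma u w + Lop s sigma v w.
Proof. by move=> Ws hu hv hw; exact: (Lop_lin N_gt0 bOm gamma1_gt0 gamma12 a Ws). Qed.

Let Lw sigma tau a u v : W sigma -> W tau -> Hs s u -> Hs s v ->
  Lop s (a *: sigma + tau) u v = a * Lop s sigma u v + Lop s tau u v.
Proof.
move=> Ws Wt hu hv; apply: Lop_weight.
- exact: (Lint_integrable N_gt0 bOm gamma1_gt0 gamma12 Ws).
- exact: (Lint_integrable N_gt0 bOm gamma1_gt0 gamma12 Wt).
Qed.

Lemma Wad_convex sigma omega (t : R) : 0 <= t <= 1 -> W sigma -> W omega ->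
  W (t *: (omega - sigma) + sigma).
Proof.
move=> /andP[t0 t1] [sp sd] [op od].
have E (r : R) : (t *: (omega - sigma) + sigma : Linf Om) r =
  t * omega r + (1 - t) * sigma r.
  have -> : omega - sigma = -1 *: sigma + omega by rewrite scaleN1r addrC.
  by rewrite !Lfun_linE; ring.
have t1' : 0 <= 1 - t by rewrite subr_ge0.
split.
  apply: filterS2 sp op => r /andP[a b] /andP[e f]; rewrite E.
  rewrite addr_ge0 ?mulr_ge0//=.
  have := ler_wpM2l t0 f; have := ler_wpM2l t1' b; lra.
have FF : Filter (almost_everywhere (mu_itv Om)) by exact: ae_filter_ringOfSetsType.
apply: filterS2 sd od => r a b rd; rewrite E.
have := ler_wpM2l t0 (b rd); have := ler_wpM2l t1' (a rd); lra.
Qed.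

(** This is half the derivative of [lower_obj] at [u] in the direction [v]. *)
Definition residual sigma u v := L2dot (S u - ydelta) (S v) + Lop s sigma u v.

Lemma residual_lin sigma a z u v : W sigma -> Hs s z -> Hs s u -> Hs s v ->
  residual sigma (a *: z + u) v = a * B sigma z v + residual sigma u v.
Proof.
move=> Ws hz hu hv; rewrite /residual Llin// /state_form.
have E x : L2dot (S x - ydelta) (S v) = L2dot (S x) (S v) - L2dot ydelta (S v).
  by rewrite -scaleN1r addrC L2dot_lin; ring.
rewrite !E (L2dot_S_lin blS).
move: (L2dot (S z) _) (L2dot (S u) _) (L2dot ydelta _) (Lop s sigma z v) (Lop s sigma u v).
by move=> *; ring.
Qed.

Lemma lower_objD sigma t u v : W sigma -> Hs s u -> Hs s v ->
  lower_obj s S ydelta sigma (t *: v + u) =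
  lower_obj s S ydelta sigma u + 2 * t * residual sigma u v + t ^+ 2 * B sigma v v.
Proof.
move=> Ws hu hv; rewrite /lower_obj !L2norm_sqr.
have hvu : Hs s (t *: v + u) by exact: Hs_linP.
have -> : Lop s sigma (t *: v + u) (t *: v + u) =
    t ^+ 2 * Lop s sigma v v + 2 * t * Lop s sigma u v + Lop s sigma u u.
  rewrite Llin// (Lop_sym _ _ v) (Lop_sym _ _ u) !Llin// (Lop_sym _ _ v u).
  by move: (Lop s sigma v v) (Lop s sigma u v) (Lop s sigma u u) => *; ring.
have ae1 : ae_eq (mu_dom oOm) setT (S (t *: v + u) - ydelta)
    (t *: S v + (S u - ydelta)).
  have FF : Filter (almost_everywhere (mu_dom oOm)) by exact: ae_filter_ringOfSetsType.
  apply: filterS (blS.1 t v u) => x + Tx => /(_ Tx) e.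
  have {}e : S (t *: v + u) x = t * S v x + S u x := e.
  change (S (t *: v + u) x - ydelta x = t * S v x + (S u x - ydelta x)).
  by rewrite e addrA.
rewrite (L2dot_ae _ ae1) L2dotC (L2dot_ae _ ae1) L2dot_sqrD (L2dotC (S v)).
rewrite /residual /state_form.
move: (L2dot (S v) (S v)) (L2dot _ (S v)) (L2dot _ _) (Lop s sigma v v)
  (Lop s sigma u v) (Lop s sigma u u).
by move=> *; ring.
Qed.

(** By [lower_objD] the objective is exactly quadratic along lines, with leading coefficient
    [B sigma v v >= 0]. At a minimum the increment has constant term 0, so its discriminant forces a
    zero linear coefficient. *)
Lemma minimizer_residual sigma u : W sigma -> Hs s u ->
  (forall v, Hs s v -> lower_obj s S ydelta sigma u <= lower_obj s S ydelta sigma v) <->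
  (forall v, Hs s v -> residual sigma u v = 0).
Proof.
move=> Ws hu; split => [H v hv|H v hv]; last first.
  have hvu : Hs s (- 1 *: u + v) by exact: Hs_linP.
  have {1}-> : v = 1 *: (- 1 *: u + v) + u.
    by rewrite scale1r scaleN1r addrC addrA subrr add0r.
  rewrite lower_objD// H// mulr0 addr0 lerDl expr1n mul1r.
  exact: state_form_ge0 Ws hvu.
have : residual sigma u v ^+ 2 <= B sigma v v * 0.
  apply: discriminant_le => t; have := H _ (Hs_linP t hv hu).
  rewrite lower_objD//.
  move: (lower_obj _ _ _ _ _) (residual _ _ _) (B _ _ _) => a b e; lra.
rewrite mulr0 => r0; apply/eqP; rewrite -sqrf_eq0 eq_le r0; exact: sqr_ge0.
Qed.

Lemma Lop_diffE sigma omega u v : W sigma -> W omega -> Hs s u -> Hs s v ->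
  Lop s (omega - sigma) u v = Lop s omega u v - Lop s sigma u v.
Proof.
move=> Ws Wo hu hv.
have -> : omega - sigma = -1 *: sigma + omega by rewrite scaleN1r addrC.
by rewrite Lw// mulN1r addrC.
Qed.

Lemma Lop_segment sigma omega t u v : W sigma -> W omega -> Hs s u -> Hs s v ->
  Lop s (t *: (omega - sigma) + sigma) u v =
  t * Lop s (omega - sigma) u v + Lop s sigma u v.
Proof.
move=> Ws Wo hu hv.
have iu := Lint_integrable N_gt0 bOm gamma1_gt0 gamma12 Ws hu hv.
have io := Lint_integrable N_gt0 bOm gamma1_gt0 gamma12 Wo hu hv.
apply: Lop_weight => //.
have := integrableB mOm2 io iu; apply: eq_integrable => // z _ /=.
have -> : omega - sigma = -1 *: sigma + omega by rewrite scaleN1r addrC.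
by rewrite /Lint Lfun_linE -EFinB; congr EFin; ring.
Qed.

(** The difference [omega - sigma] has no sign, so Cauchy-Schwarz is applied to each weight
    separately. Coercivity for [tau] then bounds both forms at [v], with [C] independent of
    [tau]. *)
Lemma Lop_diff_bounded sigma omega u : W sigma -> W omega -> Hs s u ->
  exists2 C : R, 0 <= C & forall tau v, W tau -> Hs s v ->
    Lop s (omega - sigma) u v ^+ 2 <= C * B tau v v.
Proof.
move=> Ws Wo hu.
have [K K0 HK] := state_form_coercive N_gt0 bOm Om_neq0 cOm s01 gamma1_gt0
  gamma12 delta_gt0 blS.
have g0 : 0 <= gamma2 by apply: le_trans gamma12; exact: ltW.
have Lpos rho v : W rho -> Hs s v -> 0 <= Lop s rho v v by exact: Lop_ge0.
have cs rho v : W rho -> Hs s v -> Lop s rho u v ^+ 2 <= Lop s rho u u * Lop s rho v v.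
  move=> Wr hv; apply: (@form_cauchy_schwarz R V (Hs s) (Lop s rho)) => //.
  - by move=> *; exact: Lop_sym.
  - by move=> a u1 u2 u3; exact: Llin.
  - by move=> u1; exact: Lpos.
exists (2 * (Lop s omega u u + Lop s sigma u u) * (gamma2 * K)).
  by rewrite !mulr_ge0// addr_ge0// Lpos.
move=> tau v Wt hv; rewrite Lop_diffE//.
have bnd rho : W rho -> Lop s rho v v <= gamma2 * K * B tau v v.
  move=> Wr; rewrite -lee_fin; apply: (le_trans (Lop_le N_gt0 bOm gamma1_gt0 gamma12 Wr hv)).
  by rewrite -mulrA EFinM lee_wpmul2l//; have [_] := HK tau v Wt hv.
have := le_trans (cs omega v Wo hv) (ler_wpM2l (Lpos omega u Wo hu) (bnd omega Wo)).
have := le_trans (cs sigma v Ws hv) (ler_wpM2l (Lpos sigma u Ws hu) (bnd sigma Ws)).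
move: (Lop s omega u v) (Lop s sigma u v) (Lop s omega u u) (Lop s sigma u u) (gamma2 * K)
  (B tau v v) => a b e f g h H1 H2.
have := sqr_ge0 (a + b); lra.
Qed.

End optimality.

Theorem proposition3p7 (R : realType) (N : nat) (N_gt0 : (0 < N)%N)
    (s : R) (s01 : 0 < s < 1)
    (Om : set 'rV[R]_N) (Om_neq0 : Om !=set0) (oOm : open Om)
    (cOm : connected Om) (bOm : bounded_set Om) (lipOm : lipschitz_boundary Om)
    (gamma1 gamma2 delta : R)
    (gamma1_gt0 : 0 < gamma1) (gamma12 : gamma1 <= gamma2) (delta_gt0 : 0 < delta)
    (S Sstar : L2 oOm -> L2 oOm)
    (blS : bounded_linear_op S) (adjS : adjoint S Sstar)
    (ydelta udag : L2 oOm)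
    (Reg : Linf Om -> R) (Reg_ge0 : forall sigma, 0 <= Reg sigma)
    (Reg_ae : ae_invariant Reg)
    (dReg : Linf Om -> Linf Om -> R)
    (dRegP : forall sigma, gateaux_derivative Reg sigma (dReg sigma))
    (sigma : Linf Om) (u : L2 oOm)
    (sol : bilevel_solution s gamma1 gamma2 delta S ydelta udag Reg (sigma, u)) :
  exists2 q : L2 oOm, Hs s q &
    [/\ forall omega, Wad gamma1 gamma2 delta omega ->
          0 <= dReg sigma (omega - sigma) + Lop s (omega - sigma) u q,
        forall v, Hs s v ->
          L2dot (u - udag) v + Lop s sigma q v + L2dot (Sstar (S q)) v = 0 &
        forall v, Hs s v ->
          L2dot (Sstar (S u)) v - L2dot (Sstar ydelta) v + Lop s sigma u v = 0].
Proof.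
have [fsb opt] := sol; have [/= Ws hu umin] := fsb.
have [K K0 HK] := state_form_solve N_gt0 bOm Om_neq0 cOm s01 gamma1_gt0
  gamma12 delta_gt0 blS.
pose B := state_form s S; pose one := cst1 oOm bOm.
have hone : Hs s one by exact: Hs_cst1.
have Hlin a (v w : L2 oOm) : Hs s v -> Hs s w -> Hs s (a *: v + w) by exact: Hs_lin.
have EL := (minimizer_residual N_gt0 bOm gamma1_gt0 gamma12 blS ydelta Ws hu).1 umin.
have fsbP tau v : Wad gamma1 gamma2 delta tau -> Hs s v ->
    (forall w, Hs s w -> residual s S ydelta tau v w = 0) ->
    feasible s gamma1 gamma2 delta S ydelta (tau, v).
  move=> Wt hv H; split => //=.
  exact: (minimizer_residual N_gt0 bOm gamma1_gt0 gamma12 blS ydelta Wt hv).2.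
pose e := u - udag.
have objD tau t v : bilevel_obj udag Reg (tau, t *: v + u) =
    2^-1 * (t ^+ 2 * L2dot v v + 2 * t * L2dot e v + L2dot e e) + Reg tau.
  rewrite /bilevel_obj /= L2norm_sqr -addrA -/e L2dot_sqrD (L2dotC v).
  by [].
have obj0 : bilevel_obj udag Reg (sigma, u) = 2^-1 * L2dot e e + Reg sigma.
  by rewrite /bilevel_obj /= L2norm_sqr.
(* If [S] annihilates constants, shifting [u] by a constant keeps it feasible. *)
have e_one c : c * L2dot (S one) (S one) = 0 -> c * L2dot e one = 0.
  move=> c0; have [->|cn0] := eqVneq c 0; first by rewrite mul0r.
  have S1 : L2dot (S one) (S one) = 0.
    by move/eqP: c0; rewrite mulf_eq0 (negbTE cn0)/= => /eqP.
  suff : L2dot e one ^+ 2 <= L2dot one one * 0.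
    rewrite mulr0 => le0; have /eqP : L2dot e one ^+ 2 = 0.
      by apply/eqP; rewrite eq_le le0 sqr_ge0.
    by rewrite sqrf_eq0 => /eqP ->; rewrite mulr0.
  apply: discriminant_le => t.
  have ft : feasible s gamma1 gamma2 delta S ydelta (sigma, t *: one + u).
    apply: fsbP => // [|w hw]; first exact: Hlin.
    rewrite (residual_lin N_gt0 bOm gamma1_gt0 gamma12 blS ydelta t Ws hone hu hw).
    have Bone : B sigma one w = 0.
      (* Shifting [one] by itself leaves the form unchanged, while linearity doubles it; hence it
         vanishes. *)
      have c1 : 1 * L2dot (S one) (S one) = 0 by rewrite mul1r.
      have := state_form_shift N_gt0 gamma1_gt0 gamma12 blS Ws hone hw c1.
      rewrite (state_form_lin N_gt0 bOm gamma1_gt0 gamma12 blS 1 Ws hone hone hw) mul1r.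
      by rewrite -/B => /eqP; rewrite -subr_eq0 addrK => /eqP.
    by rewrite -/B Bone EL// mulr0 addr0.
  have := opt _ ft; rewrite objD obj0.
  move: (L2dot one one) (L2dot e one) (L2dot e e) (Reg sigma) => x1 x2 x3 x4; lra.
have [K1 K10 HK1] := state_form_coercive N_gt0 bOm Om_neq0 cOm s01 gamma1_gt0
  gamma12 delta_gt0 blS.
have e_bound v : Hs s v -> (- L2dot e v) ^+ 2 <= L2dot e e * K1 * B sigma v v.
  move=> hv; have [[c [c0 cK]] _] := HK1 sigma v Ws hv.
  (* Coercivity bounds only the shifted function in L2; by [e_one] the shift is invisible to [e]. *)
  have -> : L2dot e v = L2dot e (c *: one + v).
    by rewrite [RHS]L2dotC L2dot_lin !(L2dotC _ e) e_one// add0r.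
  rewrite sqrrN; apply: (le_trans (L2dot_cauchy_schwarz _ _)).
  by rewrite -mulrA; apply: ler_wpM2l => //; exact: L2dot_ge0.
have [q [hq _ _ qF]] : exists q, [/\ Hs s q, B sigma q q <= L2dot e e * K1,
    L2dot q q <= K * (L2dot e e * K1) & forall v, Hs s v -> B sigma q v = - L2dot e v].
  apply: (HK sigma (fun v => - L2dot e v)) => //.
  - by rewrite mulr_ge0// L2dot_ge0.
  - by move=> a v w _ _; rewrite L2dotC L2dot_lin !(L2dotC _ e); ring.
exists q => //; split.
- move=> omega Wo; pose h := omega - sigma.
  have [CG CG0 HCG] := Lop_diff_bounded N_gt0 bOm Om_neq0 cOm s01 gamma1_gt0
    gamma12 delta_gt0 blS Ws Wo hu.
  have [Cq Cq0 HCq] := Lop_diff_bounded N_gt0 bOm Om_neq0 cOm s01 gamma1_gt0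
    gamma12 delta_gt0 blS Ws Wo hq.
  have Ldiff (v w : L2 oOm) (hv : Hs s v) (hw : Hs s w) :=
    Lop_diffE N_gt0 bOm gamma1_gt0 gamma12 Ws Wo hv hw.
  have Lseg (v w : L2 oOm) t (hv : Hs s v) (hw : Hs s w) :=
    Lop_segment N_gt0 bOm gamma1_gt0 gamma12 t Ws Wo hv hw.
  (* After division by [t], the terms of order [t] are half of [L2dot z z] and [Lop s h q z]; the
     two summands bound them for every [t] in []0, 1]]. *)
  pose M := K * CG + (Cq * CG + 1).
  have ineq (t : R) : 0 < t -> t <= 1 ->
      0 <= Lop s h u q + t * M + (Reg (sigma + t *: h) - Reg sigma) / t.
    move=> t0 t1; pose tau : Linf Om := t *: h + sigma.
    have Wt : Wad gamma1 gamma2 delta tau.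
      by apply: Wad_convex => //; rewrite (ltW t0).
    have [z [hz zB zz zF]] : exists z, [/\ Hs s z, B tau z z <= CG,
        L2dot z z <= K * CG & forall v, Hs s v -> B tau z v = - Lop s h u v].
      apply: (HK tau (fun v => - Lop s h u v)) => //.
      + move=> a v w hv hw; have hvw := Hlin a v w hv hw.
        rewrite /h (Ldiff u _ hu hvw) (Ldiff u v hu hv) (Ldiff u w hu hw).
        rewrite !(Lop_sym _ _ u).
        rewrite (Lop_lin N_gt0 bOm gamma1_gt0 gamma12 a Wo hv hw hu).
        rewrite (Lop_lin N_gt0 bOm gamma1_gt0 gamma12 a Ws hv hw hu).
        move: (Lop s omega v u) (Lop s sigma v u) (Lop s omega w u) (Lop s sigma w u).
        by move=> *; ring.
      + by move=> v hv; rewrite sqrrN; exact: HCG.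
    have ft : feasible s gamma1 gamma2 delta S ydelta (tau, t *: z + u).
      apply: fsbP => // [|v hv]; first exact: Hlin.
      rewrite (residual_lin N_gt0 bOm gamma1_gt0 gamma12 blS ydelta t Wt hz hu hv).
      rewrite -/B zF// /residual Lseg//.
      have := EL v hv; rewrite /residual -/h.
      move: (L2dot _ _) (Lop s h u v) (Lop s sigma u v) => x1 x2 x3; lra.
    (* Evaluate [B tau q z] twice: by the equation of [z] tested with [q], and by the equation of
       [q] tested with [z] plus the change of weight. *)
    have ez : L2dot e z = Lop s h u q + t * Lop s h q z.
      have : B tau q z = B sigma q z + t * Lop s h q z.
        by rewrite /B /state_form Lseg// -/h (addrC (t * _)) addrA.
      rewrite /B state_form_sym -/B zF// qF//.
      move: (L2dot e z) (Lop s h u q) (t * _) => x1 x2 x3; lra.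
    (* The summand 1 replaces a square root: [2 x <= x ^ 2 + 1]. *)
    have Lqz : Lop s h q z <= Cq * CG + 1.
      have : Lop s h q z ^+ 2 <= Cq * CG.
        by apply: (le_trans (HCq tau z Wt hz)); exact: ler_wpM2l.
      have := sqr_ge0 (Lop s h q z - 1); have : 0 <= Cq * CG by exact: mulr_ge0.
      move: (Lop s h q z) (Cq * CG) => x1 x2; nra.
    have := opt _ ft; rewrite objD obj0 ez /tau (addrC _ sigma).
    have fld (a b c : R) : a + t * b + c / t = (t * a + t * t * b + c) / t.
      by field; rewrite gt_eqF.
    rewrite fld => optt; apply: divr_ge0; last exact: ltW.
    move: optt.
    have := ler_wpM2l (ltW (mulr_gt0 t0 t0)) zz.
    have := ler_wpM2l (ltW (mulr_gt0 t0 t0)) Lqz.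
    have : 0 <= t * t * (K * CG) by rewrite !mulr_ge0// ltW.
    rewrite /M; move: (L2dot z z) (L2dot e e) (Lop s h q z) (Lop s h u q) (Reg _) (Reg _)
      (K * CG) (Cq * CG) => x1 x2 x3 x4 x5 x6 x7 x8; lra.
  have [_ _ /(_ h) Dh] := dRegP sigma.
  (* Only positive [t] give feasible competitors here, so the two-sided limit is restricted to the
     right. *)
  have Dr : (Reg (sigma + t *: h) - Reg sigma) / t @[t --> 0^'+] --> dReg sigma h.
    exact: cvg_dnbhs_at_right.
  have lim : Lop s h u q + t * M + (Reg (sigma + t *: h) - Reg sigma) / t @[t --> 0^'+]
      --> Lop s h u q + 0 * M + dReg sigma h.
    apply: cvgD Dr; apply: cvgD; first exact: cvg_cst.
    by apply: cvgM; [exact: cvg_at_right_filter|exact: cvg_cst].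
  rewrite -/h; have <- : Lop s h u q + 0 * M + dReg sigma h = dReg sigma h + Lop s h u q.
    by rewrite mul0r addr0 addrC.
  apply: (cvgr_to_ge lim); near=> t; apply: ineq; near: t.
    exact: nbhs_right_gt.
  exact: nbhs_right_le.
- move=> v hv.
  have -> : L2dot (Sstar (S q)) v = L2dot (S q) (S v).
    by rewrite L2dotC -adjS L2dotC.
  have := qF v hv; rewrite /B /state_form -/e.
  move: (L2dot e v) (L2dot (S q) (S v)) (Lop s sigma q v) => x1 x2 x3; lra.
- move=> v hv; have := EL v hv; rewrite /residual.
  have star w : L2dot (Sstar w) v = L2dot w (S v).
    by rewrite L2dotC -adjS L2dotC.
  have -> : S u - ydelta = -1 *: ydelta + S u by rewrite scaleN1r addrC.
  rewrite !star L2dot_lin.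
  move: (L2dot ydelta (S v)) (L2dot (S u) (S v)) (Lop s sigma u v) => x1 x2 x3; lra.
Unshelve. all: by end_near. Qed.
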